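(* Suppose the data assumption stated in the context holds. Let $\mathbf{W}=(W_H,\dots,W_1)$ be a first-order critical point of $L$ and set $r=\operatorname{rk}(W_H\cdots W_1)\le r_{max}$. Let $\mathcal{S}\subset\llbracket 1,d_y\rrbracket$ be the index set associated with $\mathbf{W}$. Then: (1) When $r=r_{max}$: (a) if $\mathcal{S}=\llbracket 1,r_{max}\rrbracket$, then $\mathbf{W}$ is a global minimizer of $L$; (b) if $\mathcal{S}\neq\llbracket 1,r_{max}\rrbracket$, then $\mathbf{W}$ is not a second-order critical point ($\mathbf{W}$ is a strict saddle point). (2) When $r<r_{max}$, $\mathbf{W}$ is a saddle point, and: (a) if $\mathcal{S}\neq\llbracket 1,r\rrbracket$, then $\mathbf{W}$ is not a second-order critical point ($\mathbf{W}$ is a strict saddle point); (b) if $\mathcal{S}=\llbracket 1,r\rrbracket$, then $$W_H\cdots W_1=U_{\mathcal{S}}U_{\mathcal{S}}^T\Sigma_{YX}\Sigma_{XX}^{-1}\in\operatorname*{arg\,min}_{R\in\mathbb{R}^{d_y\times d_x},\ \operatorname{rk}(R)\le r}\|RX-Y\|^2,$$ and moreover: (i) if $\mathbf{W}$ is not tightened, then $\mathbf{W}$ is not a second-order critical point ($\mathbf{W}$ is a strict saddle point); (ii) if $\mathbf{W}$ is tightened, then $\mathbf{W}$ is a second-order critical point ($\mathbf{W}$ is a non-strict saddle point).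
   Context: Setting. Let $H\ge 2$ and let $d_0,\dots,d_H,m$ be positive integers; write $d_x=d_0$, $d_y=d_H$, $r_{max}=\min(d_H,\dots,d_0)$. Parameters are $\mathbf{W}=(W_H,\dots,W_1)$ with $W_h\in\mathbb{R}^{d_h\times d_{h-1}}$. Given data $X\in\mathbb{R}^{d_x\times m}$, $Y\in\mathbb{R}^{d_y\times m}$, the loss is $L(\mathbf{W})=\|W_H\cdots W_1X-Y\|^2$ (Frobenius norm). Set $\Sigma_{XX}=XX^T$, $\Sigma_{YY}=YY^T$, $\Sigma_{XY}=XY^T$, $\Sigma_{YX}=YX^T$. Data assumption. $d_y\le d_x\le m$, $\Sigma_{XX}$ is invertible, $\Sigma_{XY}$ has full rank $d_y$, and, with $\Sigma^{1/2}=\Sigma_{YX}\Sigma_{XX}^{-1}X\in\mathbb{R}^{d_y\times m}$ and $\Sigma=\Sigma^{1/2}(\Sigma^{1/2})^T=\Sigma_{YX}\Sigma_{XX}^{-1}\Sigma_{XY}$, the singular values of $\Sigma^{1/2}$ are all distinct (i.e. $\Sigma$ has $d_y$ distinct eigenvalues). Let $\Sigma^{1/2}=U\Delta V^T$ be a singular value decomposition with $U\in\mathbb{R}^{d_y\times d_y}$, $V\in\mathbb{R}^{m\times m}$ orthogonal and the diagonal entries of $\Delta\in\mathbb{R}^{d_y\times m}$ in decreasing order; thus $\Sigma=U\Lambda U^T$ with $\Lambda=\operatorname{diag}(\lambda_1,\dots,\lambda_{d_y})$, $\lambda_1>\dots>\lambda_{d_y}$. Notation. $\llbracket a,b\rrbracket$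 is the set of integers from $a$ to $b$ (empty if $a>b$). For a matrix $A$ and an index set $\mathcal{J}$, $A_{\mathcal{J}}$ is the submatrix of $A$ formed by the columns indexed by $\mathcal{J}$. A product of a matrix with 0 columns and a matrix with 0 rows is the zero matrix of the appropriate size; in particular $U_\emptyset U_\emptyset^T=0$. For products of weights, $W_h\cdots W_{h'}$ with $h>h'$ is the product in decreasing index order, it equals $W_h$ if $h=h'$, and equals $I_{d_h}$ if $h'=h+1$. Critical points (gradient and Hessian taken with respect to the vectorized parameters). A first-order critical point satisfies $\nabla L(\mathbf{W})=0$; a second-order critical point satisfies in addition $\nabla^2L(\mathbf{W})\succeq0$. A saddle point is a first-order critical point that is neither a local minimizer nor a local maximizer; it is strict if it is not a second-order critical point (the Hessian has a negative eigenvalue), and non-strict if it is a second-order critical point. Associated index set. For every first-order critical point $\mathbf{W}$ of $L$, with $r=\operatorname{rk}(W_H\cdots W_1)$, there is a unique subset $\mathcal{S}\subset\llbracket 1,d_y\rrbracket$ of size $r$ such that $W_H\cdots W_1=U_{\mathcal{S}}U_{\mathcal{S}}^T\Sigma_{YX}\Sigma_{XX}^{-1}$; $\mathbf{W}$ is said to be associated with $\mathcal{S}$. Tightened. A pivot is a pair $(i,j)\in\llbracket1,H\rrbracket^2$ with $i>j$. Its two complementary blocks are $W_{j-1}\cdots W_1\Sigma_{XY}W_H\cdots W_{i+1}$ and $W_{i-1}\cdots W_{j+1}$, where empty products are identities: e.g. if $i=H$ and $j=1$ the first block is $\Sigma_{XY}$, and if $i=j+1$ the second block is $I_{d_j}$.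 For a first-order critical point $\mathbf{W}$ with $r=\operatorname{rk}(W_H\cdots W_1)$, a pivot is tightened if at least one of its two complementary blocks has rank $r$; $\mathbf{W}$ is tightened if every pivot is tightened. *)

(* Defs.v *)
(* MathComp / MathComp-Analysis *)
From HB Require Import structures.
From mathcomp Require Import all_boot all_order all_algebra.
From mathcomp Require Import all_classical all_reals all_analysis.
Set Implicit Arguments.
Unset Strict Implicit.
Unset Printing Implicit Defensive.
Import Order.TTheory GRing.Theory Num.Theory.
Import numFieldNormedType.Exports.
Local Open Scope classical_set_scope.
Local Open Scope ring_scope.

Definition frobsq (R : realType) (p q : nat) (A : 'M[R]_(p, q)) : R :=
  \sum_i \sum_j A i j ^+ 2.

Definition psd (R : realType) (n : nat) (A : 'M[R]_n) : Prop :=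
  forall v : 'rV[R]_n, 0 <= (v *m A *m v^T) 0 0.

Section CriticalPoints.
Context {R : realType} {n : nat}.
Implicit Types (f : 'rV[R]_n -> R) (x : 'rV[R]_n).

Definition gradient f x : 'rV[R]_n := \row_i 'D_(delta_mx 0 i) f x.

Definition hessian f x : 'M[R]_n :=
  \matrix_(i, j) 'D_(delta_mx 0 i) (fun y => 'D_(delta_mx 0 j) f y) x.

Definition first_order_critical f x : Prop := gradient f x = 0.

Definition second_order_critical f x : Prop :=
  first_order_critical f x /\ psd (hessian f x).

Definition local_minimizer f x : Prop := \forall y \near x, f x <= f y.

Definition local_maximizer f x : Prop := \forall y \near x, f y <= f x.

Definition global_minimizer f x : Prop := forall y, f x <= f y.

Definition saddle_point f x : Prop :=
  [/\ first_order_critical f x, ~ local_minimizer f x & ~ local_maximizer f x].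

(* For f of class C^2 the last two clauses are equivalent at a critical point:
   the Hessian is then symmetric. *)
Definition strict_saddle_point f x : Prop :=
  [/\ saddle_point f x, ~ second_order_critical f x
    & exists2 a : R, a < 0 & eigenvalue (hessian f x) a].

Definition nonstrict_saddle_point f x : Prop :=
  saddle_point f x /\ second_order_critical f x.

End CriticalPoints.

Section SVD.
Context {R : realType} {p q : nat}.

Definition is_svd (A : 'M[R]_(p, q))
    (U : 'M[R]_p) (D : 'M[R]_(p, q)) (V : 'M[R]_q) : Prop :=
  [/\ U^T *m U = 1%:M, V^T *m V = 1%:M, A = U *m D *m V^T, is_diag_mx D
    & (forall (i : 'I_p) (j : 'I_q), i = j :> nat -> 0 <= D i j) /\
      (forall (i i' : 'I_p) (j j' : 'I_q), i = j :> nat -> i' = j' :> nat ->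
        (i <= i')%N -> D i' j' <= D i j)].

(* Every real matrix has an SVD and its singular values do not depend on the
   choice of the SVD, so "in every SVD" and "in some SVD" mean the same. *)
Definition distinct_singular_values (A : 'M[R]_(p, q)) : Prop :=
  forall U D V, is_svd A U D V ->
  forall (i i' : 'I_p) (j j' : 'I_q), i = j :> nat -> i' = j' :> nat ->
    D i j = D i' j' -> i = i'.

End SVD.

(* Submatrix of the columns indexed by J, in increasing order. *)
Definition colset (R : realType) (p q : nat) (A : 'M[R]_(p, q))
    (J : {set 'I_q}) : 'M[R]_(p, #|J|) :=
  colsub (fun k : 'I_#|J| => enum_val k) A.

(* The set {1, ..., k} of 1-based indices (capped at n). *)
Definition first_indices (n k : nat) : {set 'I_n} := [set i : 'I_n | (i < k)%N].

Section Data.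
Context {R : realType} {dx dy m : nat}.
Variables (X : 'M[R]_(dx, m)) (Y : 'M[R]_(dy, m)).

Definition SigmaXX : 'M[R]_dx := X *m X^T.
Definition SigmaXY : 'M[R]_(dx, dy) := X *m Y^T.
Definition SigmaYX : 'M[R]_(dy, dx) := Y *m X^T.
Definition SigmaHalf : 'M[R]_(dy, m) := SigmaYX *m invmx SigmaXX *m X.

Definition data_assumption : Prop :=
  [/\ (dy <= dx <= m)%N, SigmaXX \in unitmx, \rank SigmaXY = dy
    & distinct_singular_values SigmaHalf].

End Data.

(* W h, for h = 0, ..., H - 1, is the weight matrix W_{h+1} of layer h + 1. *)
Definition params (R : realType) (d : nat -> nat) (H : nat) :=
  forall h : 'I_H, 'M[R]_(d h.+1, d h).

Section Network.
Context {R : realType} {d : nat -> nat} {H : nat}.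
Implicit Types W : params R d H.

Definition nparams : nat := (\sum_(h < H) d h.+1 * d h)%N.

Definition vectorize W : 'rV[R]_nparams := \mxrow_(h < H) mxvec (W h).

Definition unvectorize (w : 'rV[R]_nparams) : params R d H :=
  fun h => vec_mx (submxrow w h).

(* W extended by 0 to the indices h >= H, which are never used below. *)
Definition weight W (h : nat) : 'M[R]_(d h.+1, d h) :=
  match @idP (h < H)%N with
  | ReflectT hH => W (Ordinal hH)
  | ReflectF _ => 0
  end.

(* wprod W b a = W_b ... W_{a+1} (layers numbered from 1) for a <= b;
   for a = b, the partial identity pid_mx is the identity of size d a. *)
Fixpoint wprod W (b a : nat) : 'M[R]_(d b, d a) :=
  match b with
  | 0 => pid_mx (d a)
  | k.+1 => if (a <= k)%N then weight W k *m wprod W k a else pid_mx (d a)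
  end.

Definition rmax : nat := (\big[minn/d 0%N]_(h < H.+1) d h)%N.

Definition endtoend W : 'M[R]_(d H, d 0%N) := wprod W H 0%N.

Context {m : nat}.
Variables (X : 'M[R]_(d 0%N, m)) (Y : 'M[R]_(d H, m)).

Definition loss W : R := frobsq (endtoend W *m X - Y).

Definition vloss (w : 'rV[R]_nparams) : R := loss (unvectorize w).

Definition associated (U : 'M[R]_(d H)) W (S : {set 'I_(d H)}) : Prop :=
  #|S| = \rank (endtoend W) /\
  endtoend W = colset U S *m (colset U S)^T *m SigmaYX X Y *m invmx (SigmaXX X).

(* The pivot (i, j) uses layer numbers from 1 to H. *)
Definition tightened_pivot W (i j : nat) : Prop :=
  \rank (wprod W j.-1 0%N *m SigmaXY X Y *m wprod W H i) = \rank (endtoend W) \/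
  \rank (wprod W i.-1 j) = \rank (endtoend W).

Definition tightened W : Prop :=
  forall i j : nat, (1 <= j)%N -> (j < i)%N -> (i <= H)%N ->
    tightened_pivot W i j.

End Network.

Arguments nparams : clear implicits.
Arguments rmax : clear implicits.

Lemma vectorizeK (R : realType) (d : nat -> nat) (H : nat) (W : params R d H) :
  unvectorize (vectorize W) = W.
Proof.
apply: functional_extensionality_dep => h.
by rewrite /unvectorize /vectorize mxrowK mxvecK.
Qed.

(* Main.v *)
Require Import Defs.
From HB Require Import structures.
From mathcomp Require Import all_boot all_order all_algebra.
From mathcomp Require Import all_classical all_reals all_analysis.
From mathcomp Require Import ring lra.
Set Implicit Arguments.
Unset Strict Implicit.
Unset Printing Implicit Defensive.
Import Order.TTheory GRing.Theory Num.Theory.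
Import numFieldNormedType.Exports.
Local Open Scope classical_set_scope.
Local Open Scope ring_scope.

(** The loss depends on the weights through their product P only, and is a
    convex quadratic function of P, so everything is read off the first two
    variations of P. Along V the first variation is the sum over the layers h
    of B_h V_h A_h, where A_h and B_h are the products of the layers below and
    above h; the second one is twice the sum over the pairs l < h of
    B_h V_h C V_l A_l, where C is the product of the layers strictly between.
    Up to a factor 2 the Hessian form is the curvature
    ||P1 X||^2 + 2 <G, P2>, with G = (P X - Y) X^T and P2 the sum over pairs.
    At a critical point P = Pi N, where N is the unconstrained minimizer and
    Pi the orthogonal projector on the eigenvectors of Sigma indexed by S;
    criticality says that B_h^T G A_h^T = 0 for every layer.

    Minimality: the best approximation of rank k is the one with the k leading
    eigenvectors ([eckart_young]), which settles the global minimizers.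

    Strict saddles: if S skips an eigenvector j but contains a later one i,
    turning i into j in the first and in the last layer gives the curvature
    lam_i - lam_j < 0 ([neg_curvature_swap]). At a pivot that is not tightened,
    the middle block has larger rank than P, so it has a direction that is lost
    above or below; moving one layer along it costs nothing at first order,
    while the cross term with the other layer can be made nonzero
    ([not_tightened_neg_curvature]). Negative curvature excludes minimality by
    the second-order necessary condition ([local_minimizer_curvature]) and
    gives a negative eigenvalue by minimizing the form on the unit sphere
    ([neg_form_eigenvalue]).

    Non-strict saddles: at a tightened pivot either the pairing of G with the
    cross term vanishes or C = A_h J B_l for a generalized inverse J of P; in
    both cases B_h V_h C V_l A_l may be replaced by (B_h V_h A_h) J (B_l V_l A_l).
    By criticality the pairs in the other order contribute 0, hence
    <G, P2> = <G, P1 J P1>: the curvature is a function of P1 alone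
    ([tightened_second_variation]). In singular coordinates its nonnegativity
    is the inequality 2 a b q <= a^2 + b^2 for 0 <= q <= 1, where q is a ratio of
    a later to an earlier singular value ([spectral_pairing_ge0]).

    No local maximum exists because the loss is convex in each layer
    ([no_local_maximizer]). A critical point of rank below rmax is not a local
    minimizer either: at every layer there is room to move the weights without
    changing P. Such moves keep a local minimizer a local minimizer, hence
    critical, and a suitable sequence of them makes B_h^T G A_h^T nonzero for
    some h unless G = 0 ([low_rank_minimizer_gradmx]); but G = 0 only if P = N,
    which has full rank. *)

(** * The Frobenius inner product *)

Section Frobenius.
Context {R : realType}.

Definition frob p q (A B : 'M[R]_(p, q)) : R := \tr (A *m B^T).

Lemma frobE p q (A B : 'M[R]_(p, q)) : frob A B = \sum_i \sum_j A i j * B i j.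
Proof.
by apply: eq_bigr => i _; rewrite mxE; apply: eq_bigr => j _; rewrite mxE.
Qed.

Lemma frobsqE p q (A : 'M[R]_(p, q)) : frobsq A = frob A A.
Proof.
rewrite frobE; apply: eq_bigr => i _; apply: eq_bigr => j _.
by rewrite expr2.
Qed.

Lemma frobC p q (A B : 'M[R]_(p, q)) : frob A B = frob B A.
Proof. by rewrite /frob -mxtrace_tr trmx_mul trmxK. Qed.

Lemma frobDl p q (A B C : 'M[R]_(p, q)) : frob (A + B) C = frob A C + frob B C.
Proof. by rewrite /frob mulmxDl raddfD. Qed.

Lemma frobDr p q (A B C : 'M[R]_(p, q)) : frob A (B + C) = frob A B + frob A C.
Proof. by rewrite frobC frobDl !(frobC A). Qed.

Lemma frobZl p q a (A B : 'M[R]_(p, q)) : frob (a *: A) B = a * frob A B.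
Proof. by rewrite /frob -scalemxAl mxtraceZ. Qed.

Lemma frobZr p q a (A B : 'M[R]_(p, q)) : frob A (a *: B) = a * frob A B.
Proof. by rewrite frobC frobZl frobC. Qed.

Lemma frobNl p q (A B : 'M[R]_(p, q)) : frob (- A) B = - frob A B.
Proof. by rewrite -scaleN1r frobZl mulN1r. Qed.

Lemma frob0l p q (A : 'M[R]_(p, q)) : frob 0 A = 0.
Proof. by rewrite /frob mul0mx mxtrace0. Qed.

Lemma frob0r p q (A : 'M[R]_(p, q)) : frob A 0 = 0.
Proof. by rewrite frobC frob0l. Qed.

Lemma frob_suml p q (I : Type) (s : seq I) (P : pred I) (F : I -> 'M[R]_(p, q)) B :
  frob (\sum_(i <- s | P i) F i) B = \sum_(i <- s | P i) frob (F i) B.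
Proof. by apply: (big_morph (fun A => frob A B)) => [A C|]; rewrite ?frobDl ?frob0l. Qed.

Lemma frob_sumr p q (I : Type) (s : seq I) (P : pred I) (F : I -> 'M[R]_(p, q)) B :
  frob B (\sum_(i <- s | P i) F i) = \sum_(i <- s | P i) frob B (F i).
Proof. by rewrite frobC frob_suml; apply: eq_bigr => i _; rewrite frobC. Qed.

Lemma frob_mull p q k (M : 'M[R]_(p, k)) (A : 'M[R]_(k, q)) B :
  frob (M *m A) B = frob A (M^T *m B).
Proof. by rewrite /frob trmx_mul trmxK -mulmxA mxtrace_mulC mulmxA. Qed.

Lemma frob_mulr p q k (A : 'M[R]_(p, k)) (M : 'M[R]_(k, q)) B :
  frob (A *m M) B = frob A (B *m M^T).
Proof. by rewrite /frob trmx_mul trmxK -mulmxA. Qed.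

Lemma frobsq_ge0 p q (A : 'M[R]_(p, q)) : 0 <= frobsq A.
Proof. by apply: sumr_ge0 => i _; apply: sumr_ge0 => j _; rewrite sqr_ge0. Qed.

Lemma frobsq_eq0 p q (A : 'M[R]_(p, q)) : frobsq A = 0 -> A = 0.
Proof.
move=> /psumr_eq0P A0; apply/matrixP => i j; rewrite mxE.
have /psumr_eq0P Ai0 := A0 (fun i _ => sumr_ge0 _ (fun j _ => sqr_ge0 _)) i isT.
by apply/eqP; rewrite -sqrf_eq0 (Ai0 (fun j _ => sqr_ge0 _)).
Qed.

Lemma frobsqD p q (A B : 'M[R]_(p, q)) :
  frobsq (A + B) = frobsq A + 2 * frob A B + frobsq B.
Proof. by rewrite !frobsqE frobDl !frobDr (frobC B A); ring. Qed.

Lemma frobsqZ p q a (A : 'M[R]_(p, q)) : frobsq (a *: A) = a ^+ 2 * frobsq A.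
Proof. by rewrite !frobsqE frobZl frobZr mulrA. Qed.

Lemma frobsq_mul_unitaryl p q (U : 'M[R]_p) (A : 'M[R]_(p, q)) :
  U^T *m U = 1%:M -> frobsq (U *m A) = frobsq A.
Proof. by move=> UU; rewrite !frobsqE frob_mull mulmxA UU mul1mx. Qed.

Lemma frobsq_mul_unitaryr p q (V : 'M[R]_q) (A : 'M[R]_(p, q)) :
  V^T *m V = 1%:M -> frobsq (A *m V^T) = frobsq A.
Proof. by move=> VV; rewrite !frobsqE frob_mulr trmxK -mulmxA VV mulmx1. Qed.

Lemma frob_nondeg p q (A : 'M[R]_(p, q)) : (forall B, frob A B = 0) -> A = 0.
Proof. by move=> A0; apply: frobsq_eq0; rewrite frobsqE A0. Qed.

Lemma frob_delta p q (A : 'M[R]_(p, q)) i j : frob A (delta_mx i j) = A i j.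
Proof.
rewrite frobE (bigD1 i)//= [X in _ + X]big1 ?addr0 => [|k ki]; last first.
  by rewrite big1// => l _; rewrite mxE (negPf ki) mulr0.
rewrite (bigD1 j)//= big1 ?addr0 => [|l lj]; first by rewrite mxE !eqxx mulr1.
by rewrite mxE (negPf lj) andbF mulr0.
Qed.

(** B V A is the variation of a product when V is that of one factor, so this is
    how the gradient in that factor is extracted from directional derivatives. *)
Lemma frob_mul_eq0 p q k l (G : 'M[R]_(p, q)) (B : 'M[R]_(p, k)) (A : 'M[R]_(l, q)) :
  (forall V, frob G (B *m V *m A) = 0) -> B^T *m G *m A^T = 0.
Proof.
move=> GV; apply: frob_nondeg => V.
by rewrite frob_mulr frob_mull !trmxK mulmxA.
Qed.

(** In a neighbourhood of 0 the linear term of a quadratic polynomial dominates. *)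
Lemma quad_ge0_lin0 (a b : R) :
  (\forall t \near 0, 0 <= t * a + t ^+ 2 * b) -> a = 0.
Proof.
move=> /nbhs_ballP[e /= e0 he]; apply/eqP; rewrite -normr_le0 leNgt; apply/negP.
move=> a0; pose c := 2 * (`|b| + 1).
have b0 : 0 <= `|b| := normr_ge0 b.
have c0 : 0 < c by rewrite /c; lra.
pose t := Num.min (e / 2) (`|a| / c).
have t0 : 0 < t by rewrite lt_min !divr_gt0.
have te : t < e by rewrite (@le_lt_trans _ _ (e / 2)) ?ge_min ?lexx//; lra.
have tc : t * c <= `|a| by rewrite -ler_pdivlMr// /t ge_min lexx orbT.
have h1 : 0 <= t * a + t ^+ 2 * b.
  by apply: he; rewrite /ball/= sub0r normrN gtr0_norm.
have h2 : 0 <= (- t) * a + (- t) ^+ 2 * b.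
  by apply: he; rewrite /ball/= sub0r opprK gtr0_norm.
have h3 : `|a| <= t * `|b|.
  have bb : b <= `|b| := ler_norm b.
  rewrite ler_norml; apply/andP; split; rewrite -(ler_pM2l t0); nra.
by move: tc; rewrite /c; nra.
Qed.

End Frobenius.

(** * Derivatives of matrix-valued functions and second-order conditions *)

Section MatrixCalculus.
Context {R : realType} {n : nat}.
Implicit Types x v : 'rV[R]_n.

(** The normed-space derivative is only convenient for scalar functions, hence
    matrix-valued functions are differentiated entry by entry. *)
Definition mx_derive p q (F : 'rV[R]_n -> 'M[R]_(p, q)) x v (dF : 'M[R]_(p, q)) :=
  forall i j, is_derive x v (fun y => F y i j) (dF i j).

Lemma is_derive_ext (f g : 'rV[R]_n -> R) x v df dg :
  is_derive x v f df -> f = g -> df = dg -> is_derive x v g dg.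
Proof. by move=> ? <- <-. Qed.

Lemma is_derive_bigsum (I : finType) (F : I -> 'rV[R]_n -> R) x v (dF : I -> R) :
  (forall i, is_derive x v (F i) (dF i)) ->
  is_derive x v (fun y => \sum_i F i y) (\sum_i dF i).
Proof.
move=> dFi; rewrite -fct_sumE.
by elim/big_ind2 : _ => // [|] *; [exact: is_derive_cst|exact: is_deriveD].
Qed.

Lemma is_derive_prod (f g : 'rV[R]_n -> R) x v df dg :
  is_derive x v f df -> is_derive x v g dg ->
  is_derive x v (fun y => f y * g y) (df * g x + f x * dg).
Proof.
move=> hf hg; apply: (is_derive_ext (is_deriveM hf hg)) => //.
by rewrite addrC mulrC.
Qed.

Lemma mx_derive_cst p q (A : 'M[R]_(p, q)) x v : mx_derive (fun=> A) x v 0.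
Proof. by move=> i j; rewrite mxE; exact: is_derive_cst. Qed.

Lemma mx_deriveD p q (F G : 'rV[R]_n -> 'M[R]_(p, q)) x v dF dG :
  mx_derive F x v dF -> mx_derive G x v dG ->
  mx_derive (fun y => F y + G y) x v (dF + dG).
Proof.
move=> hF hG i j; apply: (is_derive_ext (is_deriveD (hF i j) (hG i j))).
  by apply/funext => y; rewrite mxE.
by rewrite mxE.
Qed.

Lemma mx_deriveM p q k (F : 'rV[R]_n -> 'M[R]_(p, q))
    (G : 'rV[R]_n -> 'M[R]_(q, k)) x v dF dG :
  mx_derive F x v dF -> mx_derive G x v dG ->
  mx_derive (fun y => F y *m G y) x v (dF *m G x + F x *m dG).
Proof.
move=> hF hG i j.
have h := is_derive_bigsum (fun l => is_derive_prod (hF i l) (hG l j)).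
apply: (is_derive_ext h); first by apply/funext => y; rewrite mxE.
by rewrite !mxE -big_split.
Qed.

Lemma mx_derive_sum p q (I : Type) (s : seq I) (P : pred I)
    (F : I -> 'rV[R]_n -> 'M[R]_(p, q)) x v dF :
  (forall i, P i -> mx_derive (F i) x v (dF i)) ->
  mx_derive (fun y => \sum_(i <- s | P i) F i y) x v (\sum_(i <- s | P i) dF i).
Proof.
move=> hF; elim: s => [|a s IHs].
  rewrite big_nil; have := mx_derive_cst (0 : 'M[R]_(p, q)) x v.
  by congr mx_derive; apply/funext => y; rewrite big_nil.
rewrite big_cons (_ : (fun y => _) = fun y =>
  if P a then F a y + \sum_(i <- s | P i) F i y else \sum_(i <- s | P i) F i y).
  by case: ifP => // Pa; apply: mx_deriveD => //; exact: hF.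
by apply/funext => y; rewrite big_cons.
Qed.

Lemma mx_derive_frob p q (F G : 'rV[R]_n -> 'M[R]_(p, q)) x v dF dG :
  mx_derive F x v dF -> mx_derive G x v dG ->
  is_derive x v (fun y => frob (F y) (G y)) (frob dF (G x) + frob (F x) dG).
Proof.
move=> hF hG.
have h := is_derive_bigsum (fun i =>
  is_derive_bigsum (fun j => is_derive_prod (hF i j) (hG i j))).
apply: (is_derive_ext h); first by apply/funext => y; rewrite frobE.
rewrite !frobE -big_split; apply: eq_bigr => i _.
by rewrite -big_split.
Qed.

Lemma is_derive_affine (f : 'rV[R]_n -> R) x v c :
  (forall t, f (t *: v + x) = f x + t * c) -> is_derive x v f c.
Proof.
move=> fE.
have h : (fun h => h^-1 *: ((f \o shift x) (h *: v) - f x)) @ 0^' --> c.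
  apply: cvg_near_cst; near=> t.
  have t0 : t != 0 by near: t; exact: nbhs_dnbhs_neq.
  by rewrite /= fE addrAC subrr add0r /GRing.scale/= mulrA mulVf ?mul1r.
apply: DeriveDef; first by apply/cvg_ex; exists c.
exact: cvg_lim.
Unshelve. all: by end_near. Qed.

Lemma mx_derive_affine p q (F : 'rV[R]_n -> 'M[R]_(p, q)) x v C :
  (forall t, F (t *: v + x) = F x + t *: C) -> mx_derive F x v C.
Proof. by move=> FE i j; apply: is_derive_affine => t; rewrite FE !mxE. Qed.

Lemma near_line x v (P : set 'rV[R]_n) :
  (\forall y \near x, P y) -> \forall t \near (0 : R), P (t *: v + x).
Proof.
have cv : (fun t : R => t *: v + x) @ (0 : R) --> 0 *: v + x.
  by apply: cvgD; [exact: scalel_continuous | exact: cvg_cst].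
by rewrite scale0r add0r in cv; move=> /cv.
Qed.

(** Turns directional derivatives into derivatives in one real variable, for
    which the mean value theorem is available. *)
Lemma is_derive_line (f : 'rV[R]_n -> R) x v (df : R -> R) :
  (forall t, is_derive (t *: v + x) v f (df t)) ->
  forall t, is_derive (t : R) (1 : R) (fun s => f (s *: v + x)) (df t).
Proof.
move=> hf t; have [hd he] := hf t.
have E : (fun h : R => h^-1 *: ((f \o shift (t *: v + x)) (h *: v) - f (t *: v + x)))
   = (fun h : R => h^-1 *: (((fun s : R => f (s *: v + x)) \o shift t) (h *: (1 : R)) -
            f (t *: v + x))).
  apply/funext => h /=; congr (_ *: (f _ - _)).
  by rewrite addrA -scalerDl [h *: 1]mulr1.
split; first by move: hd; rewrite /derivable E.
by move: he; rewrite /derive E.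
Qed.

End MatrixCalculus.

Section CriticalPointCalculus.
Context {R : realType} {n : nat}.
Variables (f : 'rV[R]_n -> R) (Df : 'rV[R]_n -> 'rV[R]_n -> R).
Variable (B : 'rV[R]_n -> 'rV[R]_n -> 'rV[R]_n -> R).
Hypothesis DfP : forall x v, is_derive x v f (Df x v).
Hypothesis BP : forall x u v, is_derive x u (Df ^~ v) (B x u v).
Hypothesis Df_lin : forall x a u v, Df x (a *: u + v) = a * Df x u + Df x v.
Hypothesis Bl : forall x w a u v, B x (a *: u + v) w = a * B x u w + B x v w.
Hypothesis Br : forall x w a u v, B x w (a *: u + v) = a * B x w u + B x w v.

Lemma linear_formE (F : 'rV[R]_n -> R) :
  (forall a u v, F (a *: u + v) = a * F u + F v) ->
  forall v, F v = \sum_i v 0 i * F (delta_mx 0 i).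
Proof.
move=> Flin v; have F0 : F 0 = 0.
  have := Flin 1 0 0; rewrite scale1r addr0 mul1r => /eqP.
  by rewrite -subr_eq subrr eq_sym => /eqP.
have FZ a u : F (a *: u) = a * F u by rewrite -[a *: u]addr0 Flin F0 addr0.
have FD u w : F (u + w) = F u + F w by rewrite -[u]scale1r Flin mul1r scale1r.
by rewrite {1}(row_sum_delta v) (big_morph F FD F0); apply: eq_bigr => i _.
Qed.

Lemma gradientE x : gradient f x = \row_i Df x (delta_mx 0 i).
Proof.
by apply/rowP => i; rewrite !mxE; have [_ ->] := DfP x (delta_mx 0 i).
Qed.

Lemma first_order_criticalP x :
  first_order_critical f x <-> forall v, Df x v = 0.
Proof.
rewrite /first_order_critical gradientE; split => [/rowP g0 v|D0].
  rewrite (linear_formE (Df_lin x)) big1// => i _.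
  by have := g0 i; rewrite !mxE => ->; rewrite mulr0.
by apply/rowP => i; rewrite !mxE D0.
Qed.

Lemma hessianE x i j : hessian f x i j = B x (delta_mx 0 i) (delta_mx 0 j).
Proof.
rewrite mxE (_ : (fun y => _) = Df ^~ (delta_mx 0 j)); last first.
  by apply/funext => y; have [_ ->] := DfP y (delta_mx 0 j).
by have [_ ->] := BP x (delta_mx 0 i) (delta_mx 0 j).
Qed.

(** The Hessian collects iterated derivatives along basis vectors only, so its
    value on other vectors comes from the bilinearity of B. *)
Lemma hessian_form x u v : (u *m hessian f x *m v^T) 0 0 = B x u v.
Proof.
rewrite (linear_formE (fun a u u' => Bl x v a u u')) mxE.
rewrite (eq_bigr (fun j => \sum_i u 0 i * B x (delta_mx 0 i) (delta_mx 0 j) * v 0 j)).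
  rewrite exchange_big; apply: eq_bigr => i _.
  rewrite (linear_formE (Br x (delta_mx 0 i))) mulr_sumr.
  by apply: eq_bigr => j _; rewrite -mulrA (mulrC (B _ _ _)).
move=> j _; rewrite !mxE mulr_suml; apply: eq_bigr => i _.
by rewrite hessianE.
Qed.

Lemma psd_hessianP x : psd (hessian f x) <-> forall v, 0 <= B x v v.
Proof. by split=> h v; have := h v; rewrite hessian_form. Qed.

(** Second-order necessary condition: along a direction of negative curvature
    the first derivative is negative just after 0, and so f decreases. *)
Lemma local_minimizer_curvature x v :
  local_minimizer f x -> first_order_critical f x -> 0 <= B x v v.
Proof.
move=> fmin /first_order_criticalP /(_ v) D0; rewrite leNgt; apply/negP => Bneg.
pose g t := f (t *: v + x); pose dg t := Df (t *: v + x) v.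
have gP t : is_derive (t : R) (1 : R) g (dg t).
  exact: (is_derive_line (fun s => DfP (s *: v + x) v)).
have dgP : is_derive (0 : R) (1 : R) dg (B x v v).
  have := is_derive_line (fun s => BP (s *: v + x) v v) 0.
  by rewrite scale0r add0r.
have gmin : \forall t \near (0 : R), g 0 <= g t.
  by have := near_line v fmin; rewrite /g scale0r add0r.
have dg0 : dg 0 = 0 by rewrite /dg scale0r add0r.
have dgneg : \forall t \near (0 : R)^', t^-1 * dg t < 0.
  have [/cvg_ex[l lP] dgE] := dgP.
  have lE : l = B x v v by rewrite -dgE; apply/esym/cvg_lim.
  have : (fun h : R => h^-1 *: ((dg \o shift 0) (h *: (1 : R)) - dg 0)) @ 0^' --> B x v v.
    by rewrite -lE.
  move=> /cvgr_lt /(_ _ Bneg).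
  by apply: filterS => t; rewrite /= dg0 subr0 addr0 [t *: 1]mulr1.
have /nbhs_ballP[e /= e0 he] := gmin.
have /nbhs_ballP[e' /= e'0 he'] := dgneg.
pose t := Num.min e e' / 2.
have m0 : 0 < Num.min e e' by rewrite lt_min e0.
have t0 : 0 < t by rewrite divr_gt0.
have te : t < Num.min e e' by rewrite /t; lra.
have [te1 te2] : t < e /\ t < e' by move: te; rewrite lt_min => /andP.
have gcont : {within `[0, t], continuous g}.
  apply: continuous_subspaceT => s.
  have [gd _] := gP s.
  by apply: differentiable_continuous; exact/derivable1_diffP.
have [c] := MVT t0 (fun s _ => gP s) gcont.
rewrite in_itv/= subr0 => /andP[c0 ct] gE.
have : c^-1 * dg c < 0.
  apply: he'; last by rewrite gt_eqF.
  by rewrite /ball/= sub0r normrN gtr0_norm// (lt_trans ct).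
rewrite pmulr_rlt0 ?invr_gt0// => dgc.
have : g 0 <= g t by apply: he; rewrite /ball/= sub0r normrN gtr0_norm.
rewrite -subr_ge0 gE => h.
have : dg c * t < 0 by rewrite nmulr_rlt0.
by rewrite ltNge h.
Qed.

End CriticalPointCalculus.

(** * Negative eigenvalues of symmetric matrices *)

Section NegativeEigenvalue.
Context {R : realType} {n : nat}.
Implicit Types (A : 'M[R]_n) (v : 'rV[R]_n).

Definition quadform A v : R := (v *m A *m v^T) 0 0.

Lemma quadformE A v : quadform A v = frob (v *m A) v.
Proof. by rewrite /frob [RHS]big_ord1. Qed.

Lemma quadform1 v : quadform 1%:M v = frobsq v.
Proof. by rewrite quadformE mulmx1 frobsqE. Qed.

Lemma quadformZ A a v : quadform A (a *: v) = a ^+ 2 * quadform A v.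
Proof. by rewrite !quadformE -scalemxAl frobZl frobZr mulrA. Qed.

Lemma continuous_quadform A : continuous (quadform A).
Proof.
have -> : quadform A = fun v => \sum_i (\sum_j v 0 j * A j i) * v 0 i.
  apply/funext => v; rewrite quadformE frobE big_ord1.
  by apply: eq_bigr => i _; rewrite mxE.
have sumC (F : 'I_n -> 'rV[R]_n -> R) :
    (forall i, continuous (F i)) -> continuous (fun v => \sum_i F i v).
  by move=> cF; apply: (@continuous_big _ _ +%R 0 xpredT) => //; exact: add_continuous.
have cA i j : continuous (fun w : 'rV[R]_n => w 0 j * A j i).
  by move=> w; exact: (cvgM (@coord_continuous R 1 n 0 j w) (cvg_cst (A j i))).
apply: (@sumC _) => i v.
exact: (cvgM (sumC _ (cA i) v) (@coord_continuous R 1 n 0 i v)).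
Qed.

Lemma compact_unit_sphere : compact [set v : 'rV[R]_n | frobsq v = 1].
Proof.
apply: bounded_closed_compact.
  exists 1; split; first exact: num_real.
  move=> M M1 v /= v1; rewrite [leLHS]/Num.norm/= mx_normrE.
  apply/bigmax_leP; split=> [|[i j] _ /=]; first by rewrite ltW// (lt_trans _ M1).
  apply: le_trans (ltW M1).
  rewrite -(@ler_pXn2r _ 2)// ?nnegrE// expr1n real_normK ?num_real// -v1.
  rewrite /frobsq (ord1 i) big_ord1 (bigD1 j)//= lerDl.
  by apply: sumr_ge0 => k _; rewrite sqr_ge0.
rewrite (_ : [set v | _] = quadform 1%:M @^-1` [set x | x = 1]).
  by apply: preimage_closed => [v _|]; [exact: continuous_quadform|exact: closed_eq].
by apply/seteqP; split => v /=; rewrite quadform1.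
Qed.

(** A symmetric matrix attains the least value of its quadratic form on the
    unit sphere at an eigenvector: subtracting that value leaves a nonnegative
    form with an isotropic vector, and such a vector lies in the kernel. *)
Lemma neg_form_eigenvalue A v : A^T = A -> quadform A v < 0 ->
  exists2 a : R, a < 0 & eigenvalue A a.
Proof.
move=> symA qv0.
have nv0 : 0 < frobsq v.
  rewrite lt_neqAle frobsq_ge0 andbT eq_sym; apply/eqP => /frobsq_eq0 v0.
  by rewrite v0 quadformE mul0mx frob0l ltxx in qv0.
have sphere_unit (w : 'rV[R]_n) : w != 0 -> frobsq ((Num.sqrt (frobsq w))^-1 *: w) = 1.
  move=> w0; rewrite frobsqZ exprVn sqr_sqrtr ?frobsq_ge0// mulVf//.
  by apply: contra w0 => /eqP/frobsq_eq0 ->.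
have v0 : v != 0 by apply: contraTneq nv0 => ->; rewrite frobsqE frob0l ltxx.
have S0 : [set w : 'rV[R]_n | frobsq w = 1] !=set0.
  by exists ((Num.sqrt (frobsq v))^-1 *: v); exact: sphere_unit.
have [u uS umin] := EVT_min_rV S0 compact_unit_sphere
  (continuous_subspaceT (@continuous_quadform A)).
move: uS; rewrite inE/= => u1.
set a := quadform A u in umin.
have amin w : a * frobsq w <= quadform A w.
  have [->|w0] := eqVneq w 0.
    by rewrite frobsqE quadformE mul0mx frob0l mulr0.
  have fw0 : 0 < frobsq w.
    rewrite lt_neqAle frobsq_ge0 andbT eq_sym; apply/eqP => /frobsq_eq0 w0'.
    by rewrite w0' eqxx in w0.
  have := umin ((Num.sqrt (frobsq w))^-1 *: w).
  rewrite inE /= => /(_ (sphere_unit w w0)).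
  by rewrite quadformZ exprVn sqr_sqrtr ?(ltW fw0)// ler_pdivlMl// mulrC.
exists a.
  have := amin v; rewrite leNgt => h; rewrite ltNge; apply/negP => a0.
  by move: h; rewrite (lt_le_trans qv0)// mulr_ge0// ltW.
apply/eigenvalueP; exists u; last first.
  by apply/eqP => u0; move: u1; rewrite u0 frobsqE frob0l => /esym/eqP; rewrite oner_eq0.
apply/eqP; rewrite -subr_eq0; apply/eqP; apply: frob_nondeg => w.
apply: (@quad_ge0_lin0 _ _ ((quadform A w - a * frobsq w) / 2)).
near=> t.
have := amin (u + t *: w); rewrite frobsqD frobsqZ u1 (quadformE A (_ + _)) mulmxDl.
rewrite !frobDl !frobDr -scalemxAl frobZl !frobZr !frobZl -!quadformE -/a.
have -> : frob (w *m A) u = frob (u *m A) w by rewrite frob_mulr symA frobC.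
by rewrite frobNl frobZl; nra.
Unshelve. all: by end_near. Qed.

End NegativeEigenvalue.

(** * First and second variations of the loss *)

Section NetworkProducts.
Context {R : realType} {d : nat -> nat} {H : nat}.
Implicit Types (W V : params R d H) (x v : 'rV[R]_(nparams d H)).

Lemma weightE W h (hH : (h < H)%N) : weight W h = W (Ordinal hH).
Proof.
rewrite /weight; case: {-}_ / idP => [hH'|/(_ hH)//].
by rewrite (bool_irrelevance hH' hH).
Qed.

Lemma weight_out W h : (H <= h)%N -> weight W h = 0.
Proof. by rewrite /weight leqNgt => /negP nhH; case: {-}_ / idP => // /nhH. Qed.

Lemma weight_linear (a : R) x v h :
  weight (unvectorize (a *: v + x)) h =
  a *: weight (unvectorize v) h + weight (unvectorize x) h.
Proof.
case: (ltnP h H) => hH; last by rewrite !weight_out// scaler0 addr0.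
rewrite !weightE /unvectorize -linearP; congr vec_mx.
by apply/matrixP => i j; rewrite !mxE.
Qed.

Lemma wprodnn W a : wprod W a a = 1%:M.
Proof. by case: a => [|a] /=; rewrite ?ltnn pid_mx_1. Qed.

Lemma wprodS W b a : (a <= b)%N -> wprod W b.+1 a = weight W b *m wprod W b a.
Proof. by move=> /= ->. Qed.

Lemma wprod1 W a : wprod W a.+1 a = weight W a.
Proof. by rewrite wprodS// wprodnn mulmx1. Qed.

Lemma wprod_split W b c a : (a <= c)%N -> (c <= b)%N ->
  wprod W b a = wprod W b c *m wprod W c a.
Proof.
move=> ac; elim: b => [|b IHb].
  by rewrite leqn0 => /eqP c0; subst c; rewrite wprodnn mul1mx.
rewrite leq_eqVlt => /predU1P[->|cb]; first by rewrite wprodnn mul1mx.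
by rewrite !wprodS ?(leq_trans ac)// IHb// mulmxA.
Qed.

Lemma wprod_layer W b h a : (a <= h)%N -> (h < b)%N ->
  wprod W b a = wprod W b h.+1 *m weight W h *m wprod W h a.
Proof.
by move=> ah hb; rewrite (@wprod_split W b h.+1 a)// ?(leqW ah)// wprodS// mulmxA.
Qed.

Lemma eq_wprod W V b a :
  (forall h, (a <= h < b)%N -> weight W h = weight V h) -> wprod W b a = wprod V b a.
Proof.
elim: b => [//|b IHb] WV /=; case: leqP => // ab.
rewrite WV ?ab ?leqnn// IHb// => h /andP[ah hb].
by rewrite WV// ah ltnW.
Qed.

Lemma rank_endtoend W h : (h <= H)%N -> (\rank (endtoend W) <= d h)%N.
Proof.
move=> hH; rewrite /endtoend (@wprod_split W H h)//.
by rewrite (leq_trans (mxrankM_maxr _ _))// rank_leq_row.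
Qed.

Lemma rmax_geP r : (r <= rmax d H)%N <-> forall h, (h <= H)%N -> (r <= d h)%N.
Proof.
have bigE (s : seq 'I_H.+1) : (r <= \big[minn/d 0%N]_(h <- s) d h)%N =
    (r <= d 0%N)%N && all (fun h : 'I_H.+1 => (r <= d h)%N) s.
  elim: s => [|h s IHs]; first by rewrite big_nil andbT.
  by rewrite big_cons leq_min IHs andbCA.
rewrite /rmax bigE; split=> [/andP[_ /allP rd] h hH|rd].
  by have := rd (Ordinal (hH : (h < H.+1)%N)); apply; rewrite mem_index_enum.
by rewrite rd//; apply/allP => h _; rewrite rd// -ltnS.
Qed.

(** The size of a layer depends on its index, whence the cast. *)
Definition single h (M : 'M[R]_(d h.+1, d h)) : params R d H := fun k =>
  match h =P k :> nat with
  | ReflectT e => ecast k 'M[R]_(d k.+1, d k) e M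
  | ReflectF _ => 0
  end.

Lemma weight_single h M : (h < H)%N -> weight (single M) h = M.
Proof.
move=> hH; rewrite weightE /single /=; case: eqP => // e.
by rewrite (eq_axiomK e).
Qed.

Lemma weight_single_neq h (M : 'M[R]_(d h.+1, d h)) k : h != k -> weight (single M) k = 0.
Proof.
move=> hk; case: (ltnP k H) => kH; last exact: weight_out.
by rewrite weightE /single /=; case: eqP hk => //= ->; rewrite eqxx.
Qed.

(** The first variation of a product of consecutive layers. *)
Definition dwprod W V b a : 'M[R]_(d b, d a) :=
  \sum_(a <= h < b) wprod W b h.+1 *m weight V h *m wprod W h a.

(** The part of the mixed second variation in which V moves a later layer than
    V' does; the other part has V and V' exchanged. *)
Definition d2wprod W V V' b a : 'M[R]_(d b, d a) :=
  \sum_(a <= h < b) \sum_(a <= l < h)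
     wprod W b h.+1 *m weight V h *m wprod W h l.+1 *m weight V' l *m wprod W l a.

Lemma dwprodS W V b a : (a <= b)%N ->
  dwprod W V b.+1 a = weight V b *m wprod W b a + weight W b *m dwprod W V b a.
Proof.
move=> ab; rewrite /dwprod big_nat_recr// wprodnn mul1mx addrC; congr (_ + _).
rewrite mulmx_sumr; apply: eq_big_nat => h /andP[ah hb].
by rewrite wprodS// !mulmxA.
Qed.

Lemma mx_derive_weight x v h :
  mx_derive (fun y => weight (unvectorize y) h) x v (weight (unvectorize v) h).
Proof.
by apply: mx_derive_affine => t; rewrite weight_linear addrC.
Qed.

Lemma mx_derive_wprod x v b a :
  mx_derive (fun y => wprod (unvectorize y) b a) x v
    (dwprod (unvectorize x) (unvectorize v) b a).
Proof.
elim: b => [|b IHb].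
  by rewrite /dwprod big_geq//; exact: mx_derive_cst.
case: (leqP a b) => ab.
  rewrite dwprodS// (_ : (fun y => _) =
    fun y => weight (unvectorize y) b *m wprod (unvectorize y) b a).
    exact: mx_deriveM (@mx_derive_weight x v b) IHb.
  by apply/funext => y; rewrite wprodS.
rewrite /dwprod big_geq// (_ : (fun y => _) = fun=> pid_mx (d a)).
  exact: mx_derive_cst.
by apply/funext => y /=; rewrite leqNgt ab.
Qed.

(** The same pairs of layers, enumerated from the earlier one. *)
Lemma d2wprod_exchange W V V' b a :
  \sum_(a <= l < b) dwprod W V b l.+1 *m weight V' l *m wprod W l a =
  d2wprod W V V' b a.
Proof.
pose F h l : 'M[R]_(d b, d a) :=
  wprod W b h.+1 *m weight V h *m wprod W h l.+1 *m weight V' l *m wprod W l a.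
transitivity (\sum_(a <= l < b) \sum_(a <= h < b | (l < h)%N) F h l).
  apply: eq_big_nat => l /andP[al lb].
  rewrite /dwprod !mulmx_suml (big_nat_widenl _ _ _ _ _ (leqW al)).
  by apply: eq_bigl.
rewrite (exchange_big_dep_nat xpredT)//=.
apply: eq_big_nat => h /andP[ah hb].
rewrite (big_nat_widen _ _ _ _ _ (ltnW hb)).
by apply: eq_bigl => l.
Qed.

Lemma mx_derive_dwprod x u V b a :
  mx_derive (fun y => dwprod (unvectorize y) V b a) x u
    (d2wprod (unvectorize x) (unvectorize u) V b a +
     d2wprod (unvectorize x) V (unvectorize u) b a).
Proof.
rewrite -d2wprod_exchange /d2wprod.
under [X in _ + X]eq_bigr => h _.
  rewrite (_ : \sum_(_ <= l < _) _ = wprod (unvectorize x) b h.+1 *m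
     weight V h *m dwprod (unvectorize x) (unvectorize u) h a); last first.
    by rewrite mulmx_sumr; apply: eq_bigr => l _; rewrite !mulmxA.
  over.
rewrite -big_split; apply: mx_derive_sum => h _ /=.
apply: mx_deriveM; last exact: mx_derive_wprod.
have := mx_deriveM (@mx_derive_wprod x u b h.+1) (@mx_derive_cst _ _ _ _ (weight V h) x u).
by rewrite mulmx0 addr0.
Qed.

Lemma dwprod_linear W a u v b c :
  dwprod W (unvectorize (a *: u + v)) b c =
  a *: dwprod W (unvectorize u) b c + dwprod W (unvectorize v) b c.
Proof.
rewrite /dwprod scaler_sumr -big_split; apply: eq_bigr => h _ /=.
by rewrite weight_linear mulmxDr mulmxDl -scalemxAr -scalemxAl.
Qed.

Lemma d2wprod_linearl W V a u v b c :
  d2wprod W (unvectorize (a *: u + v)) V b c =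
  a *: d2wprod W (unvectorize u) V b c + d2wprod W (unvectorize v) V b c.
Proof.
rewrite /d2wprod scaler_sumr -big_split; apply: eq_bigr => h _ /=.
rewrite scaler_sumr -big_split; apply: eq_bigr => l _ /=.
by rewrite weight_linear mulmxDr !mulmxDl -scalemxAr -!scalemxAl.
Qed.

Lemma d2wprod_linearr W V a u v b c :
  d2wprod W V (unvectorize (a *: u + v)) b c =
  a *: d2wprod W V (unvectorize u) b c + d2wprod W V (unvectorize v) b c.
Proof.
rewrite /d2wprod scaler_sumr -big_split; apply: eq_bigr => h _ /=.
rewrite scaler_sumr -big_split; apply: eq_bigr => l _ /=.
by rewrite weight_linear mulmxDr !mulmxDl -scalemxAr -!scalemxAl.
Qed.

End NetworkProducts.

Section LossCalculus.
Context {R : realType} {d : nat -> nat} {H m : nat}.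
Variables (X : 'M[R]_(d 0%N, m)) (Y : 'M[R]_(d H, m)).
Implicit Types (W V : params R d H) (x u v : 'rV[R]_(nparams d H)).

Definition residual W : 'M[R]_(d H, m) := endtoend W *m X - Y.

Definition dloss x v : R :=
  2 * frob (residual (unvectorize x))
           (dwprod (unvectorize x) (unvectorize v) H 0 *m X).

Definition d2loss x u v : R :=
  2 * (frob (dwprod (unvectorize x) (unvectorize u) H 0 *m X)
            (dwprod (unvectorize x) (unvectorize v) H 0 *m X)
       + frob (residual (unvectorize x))
              ((d2wprod (unvectorize x) (unvectorize u) (unvectorize v) H 0 +
                d2wprod (unvectorize x) (unvectorize v) (unvectorize u) H 0) *m X)).

Lemma mx_derive_residual x v :
  mx_derive (fun y => residual (unvectorize y)) x v
    (dwprod (unvectorize x) (unvectorize v) H 0 *m X).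
Proof.
have h := mx_deriveD (mx_deriveM (@mx_derive_wprod _ _ _ x v H 0%N) (@mx_derive_cst _ _ _ _ X x v))
            (@mx_derive_cst _ _ _ _ (- Y) x v).
by rewrite mulmx0 !addr0 in h.
Qed.

Lemma is_derive_vloss x v : is_derive x v (vloss X Y) (dloss x v).
Proof.
have h := mx_derive_frob (@mx_derive_residual x v) (@mx_derive_residual x v).
apply: (is_derive_ext h); first by apply/funext => y; rewrite /vloss /loss frobsqE.
by rewrite /dloss frobC; ring.
Qed.

Lemma is_derive_dloss x u v : is_derive x u (dloss ^~ v) (d2loss x u v).
Proof.
have h1 := mx_deriveM (@mx_derive_dwprod _ _ _ x u (unvectorize v) H 0%N) (@mx_derive_cst _ _ _ _ X x u).
have h := is_derive_prod (is_derive_cst (2 : R) x u) (mx_derive_frob (@mx_derive_residual x u) h1).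
apply: (is_derive_ext h) => //.
by rewrite /d2loss mulmx0 addr0 mul0r add0r.
Qed.

Lemma dloss_linear x a u v : dloss x (a *: u + v) = a * dloss x u + dloss x v.
Proof.
by rewrite /dloss dwprod_linear mulmxDl -scalemxAl frobDr frobZr; ring.
Qed.

Lemma d2loss_sym x u v : d2loss x u v = d2loss x v u.
Proof. by rewrite /d2loss frobC (addrC (d2wprod _ (unvectorize u) _ _ _)). Qed.

Lemma d2loss_linearl x w a u v :
  d2loss x (a *: u + v) w = a * d2loss x u w + d2loss x v w.
Proof.
rewrite /d2loss dwprod_linear d2wprod_linearl d2wprod_linearr.
move: (residual _) (dwprod _ _ _ _) (dwprod _ (unvectorize v) _ _)
  (dwprod _ (unvectorize w) _ _) (d2wprod _ _ _ _ _)
  (d2wprod _ (unvectorize v) _ _ _) (d2wprod _ _ (unvectorize u) _ _)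
  (d2wprod _ _ (unvectorize v) _ _) => E A B C A1 B1 A2 B2.
rewrite !mulmxDl -!scalemxAl.
by rewrite !(frobDl, frobDr, frobZl, frobZr); ring.
Qed.

Lemma d2loss_linearr x w a u v :
  d2loss x w (a *: u + v) = a * d2loss x w u + d2loss x w v.
Proof. by rewrite d2loss_sym d2loss_linearl !(d2loss_sym x w). Qed.

Lemma vloss_criticalP x :
  first_order_critical (vloss X Y) x <-> forall v, dloss x v = 0.
Proof. exact: first_order_criticalP is_derive_vloss dloss_linear x. Qed.

Lemma hessian_vloss_form x u v :
  (u *m hessian (vloss X Y) x *m v^T) 0 0 = d2loss x u v.
Proof.
exact: hessian_form is_derive_vloss is_derive_dloss d2loss_linearl d2loss_linearr x u v.
Qed.

Lemma hessian_vloss_sym x : (hessian (vloss X Y) x)^T = hessian (vloss X Y) x.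
Proof.
apply/matrixP => i j.
rewrite mxE !(hessianE is_derive_vloss is_derive_dloss).
exact: d2loss_sym.
Qed.

Lemma vloss_second_orderP x : second_order_critical (vloss X Y) x <->
  first_order_critical (vloss X Y) x /\ forall v, 0 <= d2loss x v v.
Proof.
rewrite /second_order_critical.
have := psd_hessianP is_derive_vloss is_derive_dloss d2loss_linearl d2loss_linearr x.
tauto.
Qed.

(** Half of the second derivative of the loss at W along V. *)
Definition curvature W V : R :=
  frobsq (dwprod W V H 0 *m X) + 2 * frob (residual W) (d2wprod W V V H 0 *m X).

Lemma d2loss_curvature x v :
  d2loss x v v = 2 * curvature (unvectorize x) (unvectorize v).
Proof.
by rewrite /d2loss /curvature frobsqE mulmxDl frobDr; ring.
Qed.

(** Minimality is excluded by the second-order necessary condition, and the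
    negative eigenvalue exists because the Hessian is symmetric. *)
Lemma neg_curvature_strict W V :
  first_order_critical (vloss X Y) (vectorize W) ->
  ~ local_maximizer (vloss X Y) (vectorize W) ->
  curvature W V < 0 ->
  ~ second_order_critical (vloss X Y) (vectorize W) /\
  strict_saddle_point (vloss X Y) (vectorize W).
Proof.
move=> crit nmax neg.
have dneg : d2loss (vectorize W) (vectorize V) (vectorize V) < 0.
  by rewrite d2loss_curvature !vectorizeK; nra.
have nso : ~ second_order_critical (vloss X Y) (vectorize W).
  move=> /vloss_second_orderP[_ /(_ (vectorize V))].
  by rewrite leNgt dneg.
split=> //; split=> //.
  split=> // lmin.
  have := local_minimizer_curvature is_derive_vloss is_derive_dloss
            dloss_linear (vectorize V) lmin crit.
  by rewrite leNgt dneg.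
apply: (@neg_form_eigenvalue _ _ _ (vectorize V)); first exact: hessian_vloss_sym.
by rewrite /quadform hessian_vloss_form.
Qed.

End LossCalculus.

(** * Moving along layers at a local extremum *)

Section NonzeroProducts.
Context {F : fieldType}.

Lemma ex_mulmxl_neq0 p q k (A : 'M[F]_(p, q)) : (0 < k)%N -> A != 0 ->
  exists M : 'M[F]_(k, p), M *m A != 0.
Proof.
case: k => // k _ /matrix0Pn[i [j Aij]]; exists (delta_mx 0 i).
apply/matrix0Pn; exists 0, j.
rewrite mxE (bigD1 i)//= big1 => [|l li]; rewrite !mxE !eqxx ?(negPf li) ?mul0r//.
by rewrite mul1r addr0.
Qed.

Lemma ex_mulmxr_neq0 p q k (A : 'M[F]_(p, q)) : (0 < k)%N -> A != 0 ->
  exists M : 'M[F]_(q, k), A *m M != 0.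
Proof.
move=> k0 A0; have AT0 : A^T != 0 by rewrite trmx_eq0.
have [M MA] := ex_mulmxl_neq0 k0 AT0.
by exists M^T; rewrite -trmx_eq0 trmx_mul trmxK.
Qed.

Lemma trmx_perturb p q (t : F) (A B : 'M[F]_(p, q)) :
  (A + t *: B)^T = A^T + t *: B^T.
Proof. by apply/matrixP => i j; rewrite !mxE. Qed.

Lemma mul_col_row_neq0 p q (v : 'cV[F]_p) (u : 'rV[F]_q) :
  v != 0 -> u != 0 -> v *m u != 0.
Proof.
move=> v0 u0; apply: contra v0 => /eqP vu0.
have /rV0Pn[j uj] := u0; apply/eqP/colP => i.
have /matrixP/(_ i j) := vu0; rewrite !mxE big_ord1 => /eqP.
by rewrite mulf_eq0 (negPf uj) orbF => /eqP ->.
Qed.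

Lemma left_kernel_neq0 p q (A : 'M[F]_(p, q)) : ~~ row_free A ->
  exists2 u : 'rV[F]_p, u != 0 & u *m A = 0.
Proof.
rewrite -kermx_eq0 => /rowV0Pn[u uA u0]; exists u => //.
exact/sub_kermxP.
Qed.

Lemma right_kernel_neq0 p q (A : 'M[F]_(p, q)) : (\rank A < q)%N ->
  exists2 v : 'cV[F]_q, v != 0 & A *m v = 0.
Proof.
rewrite -mxrank_tr => rA.
have [|u u0 uA] := @left_kernel_neq0 _ _ A^T; first by rewrite /row_free neq_ltn rA.
by exists u^T; rewrite ?trmx_eq0//; apply: trmx_inj; rewrite trmx_mul trmxK uA trmx0.
Qed.

End NonzeroProducts.

Section Extrema.
Context {R : realType} {n : nat}.

Lemma near0_ex (P : set R) : (\forall t \near 0, P t) -> exists2 t, t != 0 & P t.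
Proof.
move=> /nbhs_ballP[e /= e0 he]; exists (e / 2); first by rewrite gt_eqF ?divr_gt0.
by apply: he; rewrite /ball/= sub0r normrN gtr0_norm ?divr_gt0//; lra.
Qed.

(** Points with the same value inside the neighbourhood of a local extremum are
    local extrema for that same neighbourhood; Q is the order or its converse. *)
Lemma local_extremum_move (Q : R -> R -> Prop) (f : 'rV[R]_n -> R) x v :
  (\forall y \near x, Q (f x) (f y)) -> (forall t, f (t *: v + x) = f x) ->
  \forall t \near 0, \forall y \near t *: v + x, Q (f (t *: v + x)) (f y).
Proof.
move=> /near_join fx fv; apply: filterS (near_line v fx) => t.
by rewrite fv.
Qed.

End Extrema.

Section Perturbations.
Context {R : realType} {d : nat -> nat} {H m : nat}.
Variables (X : 'M[R]_(d 0%N, m)) (Y : 'M[R]_(d H, m)).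
Hypothesis d_gt0 : forall h, (h <= H)%N -> (0 < d h)%N.
Implicit Types (x v : 'rV[R]_(nparams d H)) (W V : params R d H).

Local Notation wp x := (wprod (unvectorize x)).

Definition perturb h (t : R) (M : 'M[R]_(d h.+1, d h)) x :=
  t *: vectorize (single (H := H) M) + x.

Lemma weight_perturb_neq h t (M : 'M[R]_(d h.+1, d h)) x k : h != k ->
  weight (unvectorize (perturb t M x)) k = weight (unvectorize x) k.
Proof.
by move=> hk; rewrite weight_linear vectorizeK weight_single_neq// scaler0 add0r.
Qed.

Lemma wprod_perturb_out h t (M : 'M[R]_(d h.+1, d h)) x b a : ~~ (a <= h < b)%N ->
  wp (perturb t M x) b a = wp x b a.
Proof.
move=> hab; apply: eq_wprod => k kab; apply: weight_perturb_neq.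
by apply: contraNneq hab => ->.
Qed.

Lemma wprod_perturb_in h t (M : 'M[R]_(d h.+1, d h)) x b a :
  (a <= h < b)%N -> (b <= H)%N ->
  wp (perturb t M x) b a = wp x b a + t *: (wp x b h.+1 *m M *m wp x h a).
Proof.
move=> /andP[ah hb] bH; rewrite !(wprod_layer _ ah hb).
rewrite !wprod_perturb_out ?ltnn ?andbF//.
rewrite weight_linear vectorizeK weight_single ?(leq_trans hb)//.
by rewrite addrC mulmxDr mulmxDl -scalemxAr -scalemxAl.
Qed.

(** The product of the weights is affine in each layer, hence the loss is
    quadratic in t. *)
Lemma vloss_perturb h t (M : 'M[R]_(d h.+1, d h)) x : (h < H)%N ->
  vloss X Y (perturb t M x) = vloss X Y x +
   t * (2 * frob (residual X Y (unvectorize x)) (wp x H h.+1 *m M *m wp x h 0 *m X))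
   + t ^+ 2 * frobsq (wp x H h.+1 *m M *m wp x h 0 *m X).
Proof.
move=> hH; rewrite /vloss /loss /endtoend wprod_perturb_in// mulmxDl addrAC frobsqD.
by rewrite -scalemxAl frobZr frobsqZ /residual /endtoend; ring.
Qed.

(** Half the gradient of the loss as a function of the product of the weights. *)
Definition gradmx (P : 'M[R]_(d H, d 0%N)) : 'M[R]_(d H, d 0%N) :=
  (P *m X - Y) *m X^T.

Lemma frob_residual W (A : 'M[R]_(d H, d 0%N)) :
  frob (residual X Y W) (A *m X) = frob (gradmx (endtoend W)) A.
Proof. by rewrite frobC frob_mulr frobC. Qed.

Definition layer_critical W := forall h, (h < H)%N ->
  (wprod W H h.+1)^T *m gradmx (endtoend W) *m (wprod W h 0)^T = 0.

Lemma local_minimizer_layer_critical x :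
  local_minimizer (vloss X Y) x -> layer_critical (unvectorize x).
Proof.
move=> xmin h hH; apply: frob_mul_eq0 => M; rewrite -frob_residual.
have /quad_ge0_lin0 : \forall t \near (0 : R), 0 <=
  t * (2 * frob (residual X Y (unvectorize x)) (wp x H h.+1 *m M *m wp x h 0 *m X))
   + t ^+ 2 * frobsq (wp x H h.+1 *m M *m wp x h 0 *m X).
  apply: filterS (near_line (vectorize (single M)) xmin) => t.
  by rewrite -/(perturb t M x) vloss_perturb// -addrA lerDl.
by move/eqP; rewrite mulf_eq0 pnatr_eq0 => /eqP.
Qed.

Section FullRankData.
Hypothesis X_free : row_free X.

(** The loss is convex in each layer, so at a local maximizer it is constant in
    each layer; moving the layers successively reaches a local maximizer whose
    layers below the last one have a nonzero product, and there the loss is not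
    constant in the last layer. *)
Lemma no_local_maximizer x : (0 < H)%N -> ~ local_maximizer (vloss X Y) x.
Proof.
have layer_cst z h (M : 'M[R]_(d h.+1, d h)) : (h < H)%N ->
    local_maximizer (vloss X Y) z -> wp z H h.+1 *m M *m wp z h 0 = 0.
  move=> hH zmax.
  set C := wp z H h.+1 *m M *m wp z h 0.
  set a := frob (residual X Y (unvectorize z)) (C *m X).
  have near_le : \forall t \near (0 : R),
      0 <= t * (- (2 * a)) + t ^+ 2 * (- frobsq (C *m X)).
    apply: filterS (near_line (vectorize (single M)) zmax) => t.
    by rewrite -/(perturb t M z) vloss_perturb// -/C -/a; lra.
  have a0 := quad_ge0_lin0 near_le.
  have [t t0] := near0_ex near_le; rewrite a0 mulr0 add0r mulrN oppr_ge0.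
  rewrite pmulr_rle0 ?exprn_even_gt0// => CX.
  have /frobsq_eq0 CX0 : frobsq (C *m X) = 0.
    by apply/eqP; rewrite eq_le CX frobsq_ge0.
  by apply: (row_free_inj X_free); rewrite mul0mx.
move=> H0 xmax.
have [h [hH]] : exists h, h.+1 = H by exists H.-1; rewrite prednK.
have reach k : (k <= h)%N -> exists2 z, local_maximizer (vloss X Y) z & wp z k 0 != 0.
  elim: k => [_|k IHk kh].
    exists x => //; rewrite wprodnn; apply/eqP => /matrixP.
    by move=> /(_ (Ordinal (d_gt0 (leq0n H))) (Ordinal (d_gt0 (leq0n H))));
       rewrite !mxE eqxx => /eqP; rewrite oner_eq0.
  have kH : (k < H)%N by rewrite -hH (ltn_trans kh).
  have [z zmax zk] := IHk (ltnW kh).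
  have [zk0|] := eqVneq (wp z k.+1 0) 0; last by exists z.
  have [M Mz] := ex_mulmxl_neq0 (d_gt0 kH) zk.
  have := local_extremum_move (Q := fun a b => b <= a)
    (v := vectorize (single M)) zmax.
  case=> [t|e e0 he].
    rewrite -/(perturb t M z) vloss_perturb// layer_cst// mul0mx.
    by rewrite frob0r frobsqE frob0r !mulr0 !addr0.
  have [t t0 tmax] := near0_ex (ex_intro2 _ _ e e0 he).
  exists (perturb t M z); first exact: tmax.
  rewrite (@wprod_perturb_in _ _ _ _ k.+1) ?ltnSn//.
  by rewrite zk0 add0r wprodnn mul1mx scaler_eq0 negb_or t0.
have [z zmax zh] := reach h (leqnn h).
have [M /negP[]] := ex_mulmxl_neq0 (d_gt0 (leqnn H)) zh.
by subst H; have := layer_cst z h M (ltnSn h) zmax; rewrite wprodnn mul1mx => ->.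
Qed.

End FullRankData.

Section LowRank.
Variable P : 'M[R]_(d H, d 0%N).
Hypothesis rankP : (\rank P < rmax d H)%N.

Definition flat_minimizer x :=
  local_minimizer (vloss X Y) x /\ endtoend (unvectorize x) = P.

(** A change of one layer that is absorbed by the adjacent layers keeps the
    product, hence the loss. *)
Lemma flat_minimizer_move h (M : 'M[R]_(d h.+1, d h)) x : (h < H)%N ->
  flat_minimizer x -> wp x H h.+1 *m M *m wp x h 0 = 0 ->
  exists2 t, t != 0 & flat_minimizer (perturb t M x).
Proof.
move=> hH [xmin xP] M0.
have PE t : endtoend (unvectorize (perturb t M x)) = P.
  by rewrite /endtoend wprod_perturb_in// M0 scaler0 addr0.
have := local_extremum_move (Q := fun a b => a <= b)
  (v := vectorize (single M)) xmin.
case=> [t|e e0 he].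
  by rewrite -/(perturb t M x) /vloss /loss PE xP.
have [t t0 tmin] := near0_ex (ex_intro2 _ _ e e0 he).
by exists t => //; split=> //; exact: tmin.
Qed.

Lemma rank_lt_layer h : (h <= H)%N -> (\rank P < d h)%N.
Proof. by move=> hH; move/rmax_geP: rankP; apply. Qed.

(** Layers are perturbed downwards from the last one by matrices that kill the
    product of the layers below, as long as that product has a left kernel. Their
    image is arbitrary, so it can be chosen to keep the product of the layers
    above from becoming orthogonal to G. *)
Lemma flat_minimizer_down (G : 'M[R]_(d H, d 0%N)) h x : (0 < h <= H)%N -> flat_minimizer x ->
  (wp x H h)^T *m G != 0 ->
  exists k, exists2 z, flat_minimizer z &
    [/\ (k < H)%N, row_free (wp z k 0) & (wp z H k.+1)^T *m G != 0].
Proof.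
elim: h x => [//|h IHh] x /andP[_ hH] xflat xG.
have [xfree|xnfree] := boolP (row_free (wp x h 0)); first by exists h, x.
have h0 : (0 < h)%N.
  by rewrite lt0n; apply: contraNneq xnfree => ->; rewrite wprodnn row_free_unit unitmx1.
have hhH : (0 < h <= H)%N by rewrite h0 ltnW.
have [xG0|] := eqVneq ((wp x H h)^T *m G) 0; last exact: IHh.
have [u u0 uA] := left_kernel_neq0 xnfree.
have [w wG] := ex_mulmxl_neq0 (k := 1) isT xG.
have [|t t0 tflat] := @flat_minimizer_move h (w^T *m u) x hH xflat.
  by rewrite -!mulmxA uA !mulmx0.
apply: (IHh _ hhH tflat).
rewrite wprod_perturb_in ?leqnn// wprodnn mulmx1 trmx_perturb mulmxDl xG0 add0r.
rewrite -scalemxAl scaler_eq0 negb_or t0/= !trmx_mul trmxK -!mulmxA.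
by apply: mul_col_row_neq0; rewrite ?trmx_eq0.
Qed.

(** Layers below k are perturbed upwards by matrices whose image is killed by
    the layers above: their product has at most the rank of P, less than the
    width of any layer, because the product below layer k has full row rank. *)
Lemma flat_minimizer_up k (N : 'M[R]_(d k.+1, d 0%N)) x0 j : (j <= k)%N -> (k < H)%N ->
  N != 0 -> flat_minimizer x0 -> row_free (wp x0 k 0) ->
  exists2 x, flat_minimizer x & N *m (wp x j 0)^T != 0 /\
     forall h, (j <= h)%N -> weight (unvectorize x) h = weight (unvectorize x0) h.
Proof.
move=> + kH N0 x0flat x0free; elim: j => [_|j IHj jk].
  by exists x0 => //; rewrite wprodnn trmx1 mulmx1.
have [x xflat [Nx xw]] := IHj (ltnW jk).
have jH : (j < H)%N := ltn_trans jk kH.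
have [Nx0|] := eqVneq (N *m (wp x j.+1 0)^T) 0; last first.
  by exists x => //; split=> // h jh; apply: xw; exact: ltnW.
have rankB : (\rank (wp x H j.+1) < d j.+1)%N.
  rewrite (@eq_wprod _ _ _ _ (unvectorize x0)); last first.
    by move=> h /andP[jh _]; apply: xw; exact: ltnW.
  rewrite (@wprod_split _ _ _ _ H k)// ?(ltnW kH)//.
  apply: leq_ltn_trans (mxrankM_maxl _ _) _.
  rewrite -(mxrankMfree _ x0free) -wprod_split// ?(ltnW kH)//.
  by case: x0flat => _; rewrite /endtoend => ->; apply: rank_lt_layer.
have [v v0 Bv] := right_kernel_neq0 rankB.
have [y Ny] := ex_mulmxr_neq0 (k := 1) isT Nx.
have [|t t0 tflat] := @flat_minimizer_move j (v *m y^T) x jH xflat.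
  by rewrite mulmxA Bv !mul0mx.
exists (perturb t (v *m y^T) x) => //; split.
  rewrite (@wprod_perturb_in _ _ _ _ j.+1) ?leqnn// wprodnn mul1mx trmx_perturb mulmxDr Nx0 add0r.
  rewrite -scalemxAr scaler_eq0 negb_or t0/= !trmx_mul trmxK !mulmxA.
  by apply: mul_col_row_neq0; rewrite ?trmx_eq0.
by move=> h jh; rewrite weight_perturb_neq ?xw ?(ltnW jh)// neq_ltn jh.
Qed.

(** If G were nonzero, the downward and upward moves would meet at a layer k
    where the first-order condition fails, although the point reached is still
    a local minimizer. *)
Lemma low_rank_minimizer_gradmx x : (0 < H)%N -> flat_minimizer x -> gradmx P = 0.
Proof.
move=> H0 xflat; apply/eqP; rewrite -[_ == _]negbK; apply/negP => G0.
have xG : (wp x H H)^T *m gradmx P != 0 by rewrite wprodnn trmx1 mul1mx.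
have [|k [z zflat [kH zfree zG]]] := @flat_minimizer_down (gradmx P) H x _ xflat xG.
  by rewrite H0 leqnn.
have [y [ymin yP] [/eqP Ny yw]] := flat_minimizer_up (leqnn k) kH zG zflat zfree.
apply: Ny; have := local_minimizer_layer_critical ymin kH; rewrite yP.
by rewrite (@eq_wprod _ _ _ _ (unvectorize z))// => h /andP[/ltnW kh _]; exact: yw.
Qed.

End LowRank.
End Perturbations.

(** * Orthogonal projectors, spectral data and low-rank approximation *)

Section OrthogonalProjectors.
Context {R : realType}.

Definition orthoproj p (F : 'M[R]_p) : Prop := F^T = F /\ F *m F = F.

Lemma gram_unit p q (A : 'M[R]_(p, q)) : row_free A -> A *m A^T \in unitmx.
Proof.
move=> Afree; rewrite -row_free_unit -kermx_eq0; apply/rowV0P => u /sub_kermxP uA.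
apply: (row_free_inj Afree); rewrite mul0mx; apply: frobsq_eq0.
by rewrite frobsqE /frob trmx_mul mulmxA -(mulmxA u) uA mul0mx mxtrace0.
Qed.

Lemma ex_orthoproj p q (A : 'M[R]_(p, q)) :
  exists F : 'M[R]_p, [/\ orthoproj F, F *m A = A & \tr F = (\rank A)%:R].
Proof.
have [B [C [Bfree AE]]] : exists B : 'M[R]_(p, \rank A), exists C : 'M[R]_(_, q),
    row_free B^T /\ A = B *m C.
  exists (col_base A), (row_base A); split; last by rewrite mulmx_base.
  by rewrite /row_free mxrank_tr; have := col_base_full A; rewrite /row_full.
have BB : B^T *m B \in unitmx by rewrite -{2}[B]trmxK gram_unit.
pose F := B *m invmx (B^T *m B) *m B^T; exists F.
have FB : F *m B = B by rewrite /F -!mulmxA mulVmx// mulmx1.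
split; first split.
- by rewrite /F !trmx_mul trmx_inv trmx_mul !trmxK mulmxA.
- by rewrite {2}/F !mulmxA FB.
- by rewrite [in LHS]AE mulmxA FB -AE.
- by rewrite /F mxtrace_mulC mulmxA mulmxV// mxtrace1.
Qed.

Lemma orthoproj_residual p q (F : 'M[R]_p) (A : 'M[R]_(p, q)) : orthoproj F ->
  frobsq (A - F *m A) = \tr (A *m A^T) - \tr (F *m (A *m A^T)).
Proof.
move=> [FT FF]; rewrite mulmxA -/(frob A A) -/(frob (F *m A) A) !frobsqE frobDl !frobDr !frobNl.
rewrite ![frob _ (- _)]frobC !frobNl.
by rewrite (frob_mull F A (F *m A)) FT mulmxA FF frobC; lra.
Qed.

Lemma orthoproj_contract p q (F : 'M[R]_p) (A : 'M[R]_(p, q)) : orthoproj F ->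
  frobsq (A - F *m A) <= frobsq A.
Proof.
move=> [FT FF]; have -> : frobsq A = frobsq (A - F *m A) + frobsq (F *m A).
  have := frobsqD (A - F *m A) (F *m A); rewrite subrK => ->.
  by rewrite (frobC _ (F *m A)) frob_mull FT mulmxBr mulmxA FF subrr frob0r mulr0 addr0.
by rewrite lerDl frobsq_ge0.
Qed.

(** A diagonal entry is the sum of the squares of its row, among them its own. *)
Lemma orthoproj_diag p (F : 'M[R]_p) i : orthoproj F -> 0 <= F i i <= 1.
Proof.
move=> [FT FF]; have FE : F i i = \sum_j F i j ^+ 2.
  rewrite -{1}FF mxE; apply: eq_bigr => j _.
  by rewrite expr2 -{2}FT mxE.
have F0 : 0 <= F i i by rewrite FE sumr_ge0// => j _; rewrite sqr_ge0.
rewrite F0 /=; have : F i i ^+ 2 <= F i i.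
  by rewrite {2}FE (bigD1 i)//= lerDl sumr_ge0// => j _; rewrite sqr_ge0.
by move: F0; rewrite le_eqVlt => /predU1P[<-//|F0]; nra.
Qed.

Lemma orthoproj_conj p (U F : 'M[R]_p) :
  U *m U^T = 1%:M -> orthoproj F -> orthoproj (U^T *m F *m U).
Proof.
move=> UU [FT FF]; split; first by rewrite !trmx_mul trmxK FT mulmxA.
by rewrite !mulmxA -(mulmxA (U^T *m F)) UU mulmx1 -(mulmxA U^T) FF.
Qed.

(** After subtracting from lam its value at index k, the weights c fall short of
    the indicator of the first k indices where the difference is nonnegative and
    exceed it where the difference is nonpositive. *)
Lemma weighted_sum_le_top p k (lam c : 'I_p -> R) :
  (forall i, 0 <= lam i) -> (forall i j : 'I_p, (i <= j)%N -> lam j <= lam i) ->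
  (forall i, 0 <= c i <= 1) -> \sum_i c i <= k%:R ->
  \sum_i lam i * c i <= \sum_(i < p | (i < k)%N) lam i.
Proof.
move=> lam0 lamdec c01 ck; case: (ltnP k p) => [kp|pk]; last first.
  have allk (i : 'I_p) : (i < k)%N by exact: leq_trans pk.
  rewrite [leRHS](eq_bigl xpredT) => [|i]; last exact: allk.
  by apply: ler_sum => i _; rewrite ler_piMr//; have /andP[] := c01 i.
pose th := lam (Ordinal kp).
have cardk : \sum_(i < p | (i < k)%N) 1 = k%:R :> R.
  rewrite sumr_const -sum1_card -(big_ord_widen p (fun=> 1%N) (ltnW kp)).
  by rewrite sum1_card card_ord.
have termwise i : lam i * c i - (if (i < k)%N then lam i else 0) <=
    th * (c i - (if (i < k)%N then 1 else 0)).
  have /andP[c0 c1] := c01 i; case: ltnP => ik.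
    have : th <= lam i by apply: lamdec; exact: ltnW.
    nra.
  have : lam i <= th by exact: lamdec.
  nra.
rewrite -subr_le0 [X in _ - X]big_mkcond -sumrB.
apply: le_trans (ler_sum _ (fun i _ => termwise i)) _.
rewrite -mulr_sumr sumrB -big_mkcond cardk.
have : 0 <= th by exact: lam0.
by move: ck; nra.
Qed.

End OrthogonalProjectors.

Section Data.
Context {R : realType} {dx dy m : nat}.
Variables (X : 'M[R]_(dx, m)) (Y : 'M[R]_(dy, m)).
Variables (U : 'M[R]_dy) (D : 'M[R]_(dy, m)) (V : 'M[R]_m).
Hypothesis hdata : data_assumption X Y.
Hypothesis hsvd : is_svd (SigmaHalf X Y) U D V.

Local Notation Z := (SigmaHalf X Y).

(** The unconstrained least-squares solution. *)
Definition regression : 'M[R]_(dy, dx) := SigmaYX X Y *m invmx (SigmaXX X).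

Local Notation N := regression.

Definition Sigma : 'M[R]_dy := Z *m Z^T.

(** The eigenvalues of Sigma, as the rows of D have at most one nonzero entry. *)
Definition lam (i : 'I_dy) : R := \sum_j D i j ^+ 2.

(** The orthogonal projector on the span of the eigenvectors indexed by S. *)
Definition eigproj (S : {set 'I_dy}) : 'M[R]_dy := colset U S *m (colset U S)^T.

Lemma SXX_unit : SigmaXX X \in unitmx.
Proof. by case: hdata. Qed.

Lemma X_free : row_free X.
Proof.
rewrite /row_free eqn_leq rank_leq_row /=.
have := SXX_unit; rewrite -row_free_unit => /eqP {1}<-.
exact: mxrankM_maxl.
Qed.

Lemma SYX_free : row_free (SigmaYX X Y).
Proof.
case: hdata => _ _ rXY _; rewrite /row_free -mxrank_tr.
by move: rXY; rewrite /SigmaYX /SigmaXY trmx_mul trmxK => ->.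
Qed.

Lemma regression_SXX : N *m SigmaXX X = SigmaYX X Y.
Proof. by rewrite /regression -mulmxA mulVmx ?mulmx1// SXX_unit. Qed.

Lemma regression_free : row_free N.
Proof.
rewrite /row_free eqn_leq rank_leq_row /=.
have /eqP {1}<- := SYX_free.
by rewrite -regression_SXX mxrankM_maxl.
Qed.

Lemma X_SigmaHalfT : X *m Z^T = SigmaXY X Y.
Proof.
have SXXT : (SigmaXX X)^T = SigmaXX X by rewrite /SigmaXX trmx_mul trmxK.
have SYXT : (SigmaYX X Y)^T = SigmaXY X Y by rewrite /SigmaYX /SigmaXY trmx_mul trmxK.
rewrite /SigmaHalf 2!trmx_mul trmx_inv SXXT SYXT !mulmxA mulmxV ?mul1mx//.
exact: SXX_unit.
Qed.

Lemma regression_SXY : N *m SigmaXY X Y = Sigma.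
Proof. by rewrite -X_SigmaHalfT mulmxA. Qed.

Lemma UTU : U^T *m U = 1%:M. Proof. by case: hsvd. Qed.
Lemma UUT : U *m U^T = 1%:M. Proof. exact: mulmx1C UTU. Qed.
Lemma VTV : V^T *m V = 1%:M. Proof. by case: hsvd. Qed.
Lemma VVT : V *m V^T = 1%:M. Proof. exact: mulmx1C VTV. Qed.

Lemma SigmaHalf_svd : Z = U *m D *m V^T. Proof. by case: hsvd. Qed.

Lemma dy_le_m : (dy <= m)%N.
Proof. by case: hdata => /andP[h1 h2] _ _ _; exact: leq_trans h1 h2. Qed.

Definition diag_idx (i : 'I_dy) : 'I_m := widen_ord dy_le_m i.

Lemma D_diag (i : 'I_dy) (j : 'I_m) : i != j :> nat -> D i j = 0.
Proof. by case: hsvd => _ _ _ /is_diag_mxP h _; exact: h. Qed.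

Lemma lamE i : lam i = D i (diag_idx i) ^+ 2.
Proof.
rewrite /lam (bigD1 (diag_idx i))//= big1 ?addr0// => j ji.
rewrite D_diag ?expr0n//; apply: contra ji => /eqP ij.
by apply/eqP/val_inj.
Qed.

Lemma DDT : D *m D^T = diag_mx (\row_i lam i).
Proof.
apply/matrixP => i j; rewrite mxE [RHS]mxE mxE.
have [<-|ij] := eqVneq i j; first by apply: eq_bigr => l _; rewrite mxE expr2.
rewrite mulr0n big1// => l _; rewrite mxE.
have [il|il] := eqVneq (i : nat) (l : nat); last by rewrite (@D_diag i) ?mul0r.
by rewrite (@D_diag j) ?mulr0// -il; apply: contra ij => /eqP/val_inj ->.
Qed.

Lemma Sigma_eig : Sigma = U *m diag_mx (\row_i lam i) *m U^T.
Proof.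
rewrite /Sigma SigmaHalf_svd !trmx_mul trmxK -!mulmxA; congr (_ *m _).
by rewrite -DDT !mulmxA -(mulmxA D) VTV mulmx1.
Qed.

Lemma SigmaHalf_free : row_free Z.
Proof.
have : row_free (Z *m X^T).
  by rewrite /SigmaHalf -mulmxA -/(SigmaXX X) regression_SXX SYX_free.
rewrite /row_free !eqn_leq !rank_leq_row /= => /leq_trans; apply.
exact: mxrankM_maxl.
Qed.

Lemma Sigma_unit : Sigma \in unitmx.
Proof. exact: gram_unit SigmaHalf_free. Qed.

Lemma singular_ge0 i : 0 <= D i (diag_idx i).
Proof. by case: hsvd => _ _ _ _ [h _]; exact: h. Qed.

Lemma lam_gt0 i : 0 < lam i.
Proof.
rewrite lt_neqAle sumr_ge0 ?andbT => [|j _]; last exact: sqr_ge0.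
apply/negP => /eqP lam0; have := Sigma_unit.
rewrite Sigma_eig !unitmx_mul -(row_free_unit (diag_mx _)) => /andP[/andP[_ dfree] _].
have : delta_mx 0 i = 0 :> 'rV[R]_dy.
  apply: (row_free_inj dfree); rewrite mul0mx -rowE; apply/rowP => j.
  by rewrite !mxE -lam0 mul0rn.
by move=> /rowP/(_ i); rewrite !mxE !eqxx => /eqP; rewrite oner_eq0.
Qed.

Lemma lam_lt (i j : 'I_dy) : (i < j)%N -> lam j < lam i.
Proof.
move=> ij; rewrite !lamE ltr_pXn2r// ?nnegrE ?singular_ge0//.
rewrite lt_neqAle; apply/andP; split; last first.
  by case: hsvd => _ _ _ _ [_ h]; apply: h => //; exact: ltnW.
apply/negP => /eqP Dij; case: hdata => _ _ _ /(_ U D V hsvd) h.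
have := h j i (diag_idx j) (diag_idx i) erefl erefl Dij.
by move=> ji; rewrite ji ltnn in ij.
Qed.

Lemma lam_le (i j : 'I_dy) : (i <= j)%N -> lam j <= lam i.
Proof.
by rewrite leq_eqVlt => /predU1P[/val_inj ->//|/lam_lt/ltW].
Qed.

Lemma eigprojE S : eigproj S = U *m diag_mx (\row_i (i \in S)%:R) *m U^T.
Proof.
apply/matrixP => i j; rewrite mxE [RHS]mxE.
under eq_bigr => l _ do rewrite !mxE.
rewrite -(big_enum_val (fun l => U i l * U j l)) /= big_mkcond /=.
apply: eq_bigr => l _; rewrite mul_mx_diag !mxE.
by case: (l \in S); rewrite ?mulr1 ?mulr0 ?mul0r.
Qed.

Lemma eigproj_ortho S : orthoproj (eigproj S).
Proof.
split; first by rewrite /eigproj trmx_mul trmxK.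
rewrite eigprojE !mulmxA -(mulmxA (U *m _)) UTU mulmx1 -(mulmxA U) mulmx_diag.
congr (_ *m diag_mx _ *m _); apply/rowP => i; rewrite !mxE.
by case: (i \in S); rewrite ?mulr1 ?mulr0.
Qed.

Lemma eigproj_Sigma S : eigproj S *m Sigma = Sigma *m eigproj S.
Proof.
rewrite eigprojE Sigma_eig !mulmxA -!(mulmxA _ U^T U) UTU !mulmx1.
by rewrite -!(mulmxA U) !mulmx_diag; congr (U *m (diag_mx _ *m _));
   apply/rowP => i; rewrite !mxE mulrC.
Qed.

Lemma eigproj_col S i : eigproj S *m col i U = (i \in S)%:R *: col i U.
Proof.
rewrite eigprojE -2!mulmxA.
have -> : U^T *m col i U = delta_mx i 0 by rewrite colE mulmxA UTU mul1mx.
rewrite -colE (_ : col i (diag_mx _) = (i \in S)%:R *: delta_mx i 0).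
  by rewrite -scalemxAr -colE.
by apply/colP => j; rewrite !mxE andbT eq_sym; case: eqVneq => [->|]; rewrite ?mulr1 ?mulr0.
Qed.

Lemma trace_eigproj_Sigma S : \tr (eigproj S *m Sigma) = \sum_(i in S) lam i.
Proof.
rewrite eigprojE Sigma_eig !mulmxA -!(mulmxA _ U^T U) UTU !mulmx1.
rewrite mxtrace_mulC !mulmxA UTU mul1mx mulmx_diag mxtrace_diag [RHS]big_mkcond.
apply: eq_bigr => i _; rewrite !mxE.
by case: (i \in S); rewrite ?mul1r ?mul0r.
Qed.

(** The fit splits orthogonally at the projection of Y on the row space of X. *)
Lemma fit_pythagoras (M : 'M[R]_(dy, dx)) :
  frobsq (M *m X - Y) = frobsq (M *m X - Z) + frobsq (Z - Y).
Proof.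
rewrite -(subrKA Z) (frobsqD (M *m X - Z)) (_ : frob _ _ = 0) ?mulr0 ?addr0//.
rewrite {1}/SigmaHalf -mulmxBl frob_mulr.
suff -> : (Z - Y) *m X^T = 0 by rewrite frob0r.
have ZX : Z *m X^T = SigmaYX X Y by rewrite -regression_SXX -mulmxA.
by rewrite mulmxBl ZX subrr.
Qed.

(** Eckart-Young: the image of a matrix of rank at most k misses at least the
    trace of Sigma minus what an orthogonal projector of trace k can capture,
    and the first k eigenvectors capture most. *)
Lemma eckart_young k (M : 'M[R]_(dy, dx)) : (\rank M <= k)%N ->
  frobsq (eigproj (first_indices dy k) *m N *m X - Y) <= frobsq (M *m X - Y).
Proof.
move=> rM; rewrite (fit_pythagoras M) (fit_pythagoras (_ *m N)) lerD2r.
have [F [Fproj FM trF]] := ex_orthoproj (M *m X).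
have step : frobsq (Z - F *m Z) <= frobsq (M *m X - Z).
  have -> : frobsq (M *m X - Z) = frobsq (Z - M *m X).
    by rewrite -opprB !frobsqE frobNl frobC frobNl opprK.
  apply: le_trans (orthoproj_contract _ Fproj).
  by rewrite mulmxBr FM opprB addrA subrK.
apply: le_trans step.
have -> : frobsq (eigproj (first_indices dy k) *m N *m X - Z) =
    frobsq (Z - eigproj (first_indices dy k) *m Z).
  by rewrite -opprB !frobsqE frobNl frobC frobNl opprK -mulmxA.
rewrite !orthoproj_residual//; last exact: eigproj_ortho.
rewrite lerD2l lerN2 -/Sigma trace_eigproj_Sigma.
have trFS : \tr (F *m Sigma) = \sum_i lam i * (U^T *m F *m U) i i.
  rewrite Sigma_eig !mulmxA mxtrace_mulC !mulmxA; apply: eq_bigr => i _.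
  by rewrite mul_mx_diag !mxE mulrC.
rewrite trFS; have Gproj := orthoproj_conj UUT Fproj.
have trG : \sum_i (U^T *m F *m U) i i <= k%:R.
  rewrite -/(\tr _) mxtrace_mulC mulmxA UUT mul1mx trF ler_nat.
  exact: leq_trans (mxrankM_maxl _ _) rM.
apply: le_trans (weighted_sum_le_top _ lam_le _ trG) _.
- by move=> i; exact/ltW/lam_gt0.
- by move=> i; exact: orthoproj_diag.
by rewrite le_eqVlt; apply/orP; left; apply/eqP/eq_bigl => i; rewrite inE.
Qed.

End Data.

(** * Rank factorizations and directions supported by two layers *)

Section RankFactorizations.
Context {F : fieldType}.

Lemma rank_mulr_factor p q k (A : 'M[F]_(p, q)) (B : 'M[F]_(q, k)) :
  \rank (A *m B) = \rank A -> exists C, A = A *m B *m C.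
Proof.
move=> rAB; have sub : ((A *m B)^T <= A^T)%MS by rewrite trmx_mul submxMl.
have AB : (A^T <= (A *m B)^T)%MS.
  by have [_ <-] := mxrank_leqif_sup sub; rewrite !mxrank_tr rAB.
have [C AC] := submxP AB; exists C^T.
by apply: trmx_inj; rewrite [RHS]trmx_mul trmxK.
Qed.

Lemma rank_mull_factor p q k (B : 'M[F]_(k, p)) (A : 'M[F]_(p, q)) :
  \rank (B *m A) = \rank A -> exists C, A = C *m (B *m A).
Proof.
move=> rBA; have [|C AC] := @rank_mulr_factor _ _ _ A^T B^T.
  by rewrite -trmx_mul !mxrank_tr.
by exists C^T; apply: trmx_inj; rewrite [RHS]trmx_mul trmxK trmx_mul.
Qed.

(** When a product has the rank of its middle factor C, no information is lost
    on either side of C, which is then recovered from the outer products and a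
    generalized inverse of the whole. *)
Lemma middle_factor p q k l (L : 'M[F]_(p, q)) (C : 'M[F]_(q, k)) (N : 'M[F]_(k, l)) G :
  \rank (L *m C *m N) = \rank C ->
  L *m C *m N *m G *m (L *m C *m N) = L *m C *m N ->
  C = C *m N *m G *m (L *m C).
Proof.
move=> rk GP; have rLC : \rank (L *m C) = \rank C.
  by apply/eqP; rewrite eqn_leq mxrankM_maxr -rk mxrankM_maxl.
have rLCN : \rank (L *m C *m N) = \rank (L *m C) by rewrite rk rLC.
have [Q1 LCE] := rank_mulr_factor rLCN; have [Q2 CE] := rank_mull_factor rLC.
have LE : L *m C *m N *m G *m (L *m C) = L *m C.
  by rewrite {2}LCE mulmxA GP -LCE.
have QLC : Q2 *m L *m C = C by rewrite -mulmxA -CE.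
have CE' : C = Q2 *m (L *m C *m N *m G *m (L *m C)) by rewrite LE.
by rewrite {1}CE' !mulmxA QLC.
Qed.

(** The kernel of C N is then too large to be contained in that of C. *)
Lemma kernel_gap p q k (C : 'M[F]_(p, q)) (N : 'M[F]_(q, k)) :
  (\rank (C *m N) < \rank C)%N ->
  exists2 b : 'rV[F]_p, b *m C *m N = 0 & b *m C != 0.
Proof.
move=> rk; have /row_subPn[i ri] : ~~ (kermx (C *m N) <= kermx C)%MS.
  apply/negP => /mxrankS; rewrite !mxrank_ker leqNgt => /negP[].
  by rewrite ltn_sub2l// (leq_trans rk)// rank_leq_row.
exists (row i (kermx (C *m N))); last by apply: contra ri => /eqP/sub_kermxP.
by rewrite -mulmxA; apply/sub_kermxP; exact: row_sub.
Qed.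

(** By the Frobenius inequality, L C and C N cannot both have the rank of C. *)
Lemma middle_rank_drop p q k l (L : 'M[F]_(p, q)) (C : 'M[F]_(q, k)) (N : 'M[F]_(k, l)) :
  (\rank (L *m C *m N) < \rank C)%N ->
  (exists2 c : 'cV[F]_k, L *m C *m c = 0 & C *m c != 0) \/
  (exists2 b : 'rV[F]_q, b *m C *m N = 0 & b *m C != 0).
Proof.
move=> rk; case: (ltnP (\rank (C *m N)) (\rank C)) => [/kernel_gap|rCN]; first by right.
left; have rLC : (\rank (C^T *m L^T) < \rank C^T)%N.
  rewrite -trmx_mul !mxrank_tr ltnNge; apply/negP => rLC.
  have := mxrank_Frobenius L C N.
  rewrite leqNgt => /negP[]; apply: leq_trans (leq_add rLC rCN).
  by rewrite ltn_add2l.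
have [b bC b0] := kernel_gap rLC; exists b^T.
  by apply: trmx_inj; rewrite !trmx_mul trmxK trmx0 mulmxA.
by rewrite -trmx_eq0 trmx_mul trmxK.
Qed.

End RankFactorizations.

Section FewLayers.
Context {R : realType} {d : nat -> nat} {H m : nat}.
Variables (X : 'M[R]_(d 0%N, m)) (Y : 'M[R]_(d H, m)).
Implicit Types (W V : params R d H).

Lemma big_nat_single (V : nmodType) (F : nat -> V) a b h :
  (a <= h < b)%N -> (forall k, (a <= k < b)%N -> k != h -> F k = 0) ->
  \sum_(a <= k < b) F k = F h.
Proof.
move=> hab F0; rewrite (bigD1_seq h)/= ?mem_index_iota ?iota_uniq//.
rewrite big_seq_cond big1 ?addr0// => k; rewrite mem_index_iota => /andP[kab kh].
exact: F0.
Qed.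

Lemma dwprod_single W h (M : 'M[R]_(d h.+1, d h)) : (h < H)%N ->
  dwprod W (single M) H 0 = wprod W H h.+1 *m M *m wprod W h 0.
Proof.
move=> hH; rewrite /dwprod (@big_nat_single _ _ 0 H h)//.
  by rewrite weight_single.
by move=> k _ kh; rewrite weight_single_neq 1?eq_sym// mulmx0 mul0mx.
Qed.

Lemma critical_layer_critical W :
  first_order_critical (vloss X Y) (vectorize W) -> layer_critical X Y W.
Proof.
move=> /vloss_criticalP crit h hH; apply: frob_mul_eq0 => M.
have := crit (vectorize (single M)).
rewrite /dloss !vectorizeK dwprod_single// -frob_residual.
by move/eqP; rewrite mulf_eq0 pnatr_eq0 => /eqP.
Qed.

Definition two_layers h (M : 'M[R]_(d h.+1, d h)) l (M' : 'M[R]_(d l.+1, d l)) :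
  params R d H := fun k => single M k + single M' k.

Lemma weight_two_layers h (M : 'M[R]_(d h.+1, d h)) l (M' : 'M[R]_(d l.+1, d l)) k :
  weight (two_layers M M') k =
  weight (single (H := H) M) k + weight (single (H := H) M') k.
Proof.
case: (ltnP k H) => kH; first by rewrite !weightE.
by rewrite !weight_out// addr0.
Qed.

Lemma dwprod_two_layers W h (M : 'M[R]_(d h.+1, d h)) l (M' : 'M[R]_(d l.+1, d l)) :
  (h < H)%N -> (l < H)%N ->
  dwprod W (two_layers M M') H 0 =
  wprod W H h.+1 *m M *m wprod W h 0 + wprod W H l.+1 *m M' *m wprod W l 0.
Proof.
move=> hH lH; rewrite -!dwprod_single// -big_split; apply: eq_bigr => k _ /=.
by rewrite weight_two_layers mulmxDr mulmxDl.
Qed.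

Lemma d2wprod_two_layers W h (M : 'M[R]_(d h.+1, d h)) l (M' : 'M[R]_(d l.+1, d l)) :
  (l < h < H)%N ->
  d2wprod W (two_layers M M') (two_layers M M') H 0 =
  wprod W H h.+1 *m M *m wprod W h l.+1 *m M' *m wprod W l 0.
Proof.
move=> /andP[lh hH]; have lH := ltn_trans lh hH.
have wh : weight (two_layers M M') h = M.
  by rewrite weight_two_layers weight_single// weight_single_neq ?addr0// neq_ltn lh.
have wl : weight (two_layers M M') l = M'.
  by rewrite weight_two_layers weight_single// weight_single_neq ?add0r// neq_ltn lh orbT.
have wn k : k != h -> k != l -> weight (two_layers M M') k = 0.
  by move=> kh kl; rewrite weight_two_layers !weight_single_neq ?addr0// eq_sym.
rewrite /d2wprod (@big_nat_single _ _ 0 H h)//.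
  rewrite (@big_nat_single _ _ 0 h l)// ?wh ?wl// => k /andP[_ kh] kl.
  by rewrite wn ?mulmx0 ?mul0mx// neq_ltn kh.
move=> k /andP[_ kH] kh; rewrite big_nat big1// => k' /andP[_ k'k].
have [kl|kl] := eqVneq k l; last by rewrite (wn k)// mulmx0 !mul0mx.
subst k; rewrite (wn k') ?mulmx0 ?mul0mx// neq_ltn ?k'k//.
by rewrite (ltn_trans k'k).
Qed.

Lemma quad_neg (p g : R) : 0 <= p -> g != 0 -> exists s, s ^+ 2 * p + 2 * (s * g) < 0.
Proof.
move=> p0 g0.
(* The minimizer of s ^+ 2 * (p + 1) + 2 * (s * g). *)
exists (- g / (p + 1)).
have p1 : 0 < p + 1 by lra.
rewrite -(pmulr_llt0 _ (exprn_gt0 2 p1)).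
have -> : ((- g / (p + 1)) ^+ 2 * p + 2 * (- g / (p + 1) * g)) * (p + 1) ^+ 2 =
   - (g ^+ 2 * (p + 2)).
  by field; rewrite gt_eqF.
rewrite oppr_lt0 mulr_gt0//; last lra.
by rewrite exprn_even_gt0.
Qed.

(** When one of the two layers does not move the product to first order, the
    cross term dominates for a small motion of the other one. *)
Lemma neg_curvature_two_layers W h (M : 'M[R]_(d h.+1, d h)) l
    (M' : 'M[R]_(d l.+1, d l)) : (l < h < H)%N ->
  wprod W H h.+1 *m M *m wprod W h 0 = 0 \/
  wprod W H l.+1 *m M' *m wprod W l 0 = 0 ->
  frob (gradmx X Y (endtoend W))
    (wprod W H h.+1 *m M *m wprod W h l.+1 *m M' *m wprod W l 0) != 0 ->
  exists V, curvature X Y W V < 0.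
Proof.
move=> lhH; have /andP[lh hH] := lhH; have lH := ltn_trans lh hH.
move=> zero /quad_neg g0.
have [MZ|M'Z] := zero.
  have [s sneg] := g0 _ (frobsq_ge0 (wprod W H l.+1 *m M' *m wprod W l 0 *m X)).
  exists (two_layers M (s *: M')); move: sneg.
  rewrite /curvature dwprod_two_layers// d2wprod_two_layers// MZ add0r frob_residual.
  by rewrite -!scalemxAr -!scalemxAl frobZr frobsqZ.
have [s sneg] := g0 _ (frobsq_ge0 (wprod W H h.+1 *m M *m wprod W h 0 *m X)).
exists (two_layers (s *: M) M'); move: sneg.
rewrite /curvature dwprod_two_layers// d2wprod_two_layers// M'Z addr0 frob_residual.
by rewrite -!scalemxAr -!scalemxAl frobZr frobsqZ.
Qed.

End FewLayers.

(** * The product of the weights at a critical point *)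

Section IndexSets.

Lemma card_first_indices n k : (k <= n)%N -> #|first_indices n k| = k.
Proof.
move=> kn; rewrite -sum1_card (eq_bigl (fun i : 'I_n => (i < k)%N)); last first.
  by move=> i; rewrite inE.
by rewrite -(big_ord_widen n (fun=> 1%N) kn) sum1_card card_ord.
Qed.

Lemma not_first_indices n (S : {set 'I_n}) : S <> first_indices n #|S| ->
  exists i j : 'I_n, [/\ i \in S, j \notin S & (j < i)%N].
Proof.
move=> Sne; apply: contrapT => nex; apply: Sne.
have down (i j : 'I_n) : i \in S -> (j <= i)%N -> j \in S.
  rewrite leq_eqVlt => iS /predU1P[/val_inj ->//|ji].
  by apply: contra_notT nex => jS; exists i, j.
have Sn : (#|S| <= n)%N by rewrite -[X in (_ <= X)%N]card_ord max_card.
apply/eqP; rewrite eqEcard card_first_indices// leqnn andbT.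
apply/fintype.subsetP => i iS; rewrite inE -(card_first_indices (ltn_ord i)).
by apply/subset_leq_card/fintype.subsetP => j; rewrite inE ltnS => /(down i); apply.
Qed.

End IndexSets.

(** The product of the weights at a critical point is P = Pi N, where N is the
    unconstrained minimizer and Pi a spectral projector of Sg = N SXY. *)
Section CriticalProduct.
Context {F : fieldType} {p q : nat}.
Variables (N : 'M[F]_(p, q)) (SXY : 'M[F]_(q, p)) (Pi Sg : 'M[F]_p).
Hypothesis Pi_idem : Pi *m Pi = Pi.
Hypothesis Pi_Sg : Pi *m Sg = Sg *m Pi.
Hypothesis N_SXY : N *m SXY = Sg.
Hypothesis Sg_unit : Sg \in unitmx.

Lemma sandwich : Pi *m N *m SXY *m (Pi *m N) = Sg *m (Pi *m N).
Proof. by rewrite -(mulmxA Pi N) N_SXY Pi_Sg -mulmxA (mulmxA Pi Pi) Pi_idem. Qed.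

Lemma rank_sandwich : \rank (Pi *m N *m SXY *m (Pi *m N)) = \rank (Pi *m N).
Proof.
rewrite sandwich -mxrank_tr trmx_mul -[RHS]mxrank_tr.
by apply: mxrankMfree; rewrite row_free_unit unitmx_tr.
Qed.

Lemma ginvP :
  Pi *m N *m (SXY *m invmx Sg *m Pi) *m (Pi *m N) = Pi *m N.
Proof.
rewrite !mulmxA -(mulmxA Pi N) N_SXY -(mulmxA Pi Sg) mulmxV// mulmx1.
by rewrite !Pi_idem.
Qed.

Section Factorizations.
Context {a b : nat}.
Variables (Bl : 'M[F]_(p, a)) (Al : 'M[F]_(a, q)) (Bh : 'M[F]_(p, b)) (Ah : 'M[F]_(b, q)).
Hypothesis PlE : Bl *m Al = Pi *m N.
Hypothesis PhE : Bh *m Ah = Pi *m N.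

Let T := Al *m SXY *m Bh.

Lemma block_sandwich : Bl *m T *m Ah = Pi *m N *m SXY *m (Pi *m N).
Proof. by rewrite -{1}PlE -PhE /T !mulmxA. Qed.

(** The block is a factor of P SXY P = Sg P, which has the rank of P. *)
Lemma rank_block : (\rank (Pi *m N) <= \rank T)%N.
Proof.
rewrite -rank_sandwich -block_sandwich.
exact: leq_trans (mxrankM_maxl _ _) (mxrankM_maxr _ _).
Qed.

Hypothesis rankPi : (\rank Pi <= \rank (Pi *m N))%N.

(** Otherwise the block would factor through Pi. *)
Lemma block_neq0 : (\rank (Pi *m N) < \rank T)%N ->
  Al *m SXY *m (1%:M - Pi) *m Bh != 0.
Proof.
apply: contraTneq; rewrite mulmxBr mulmx1 mulmxBl -/T => /eqP.
rewrite subr_eq0 => /eqP ->; rewrite -leqNgt (leq_trans _ rankPi)//.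
exact: leq_trans (mxrankM_maxl _ _) (mxrankM_maxr _ _).
Qed.

(** When the block has the least possible rank, its image is the image of its
    part in the range of Pi, and the factor above it is injective there. *)
Lemma block_eq0 : \rank T = \rank (Pi *m N) ->
  Al *m SXY *m (1%:M - Pi) *m Bh = 0.
Proof.
move=> rT; pose TS := Al *m SXY *m Pi *m Bh.
have TE : Al *m SXY *m (1%:M - Pi) *m Bh = T - TS.
  by rewrite mulmxBr mulmx1 mulmxBl.
have rBTA : \rank (Bl *m T *m Ah) = \rank T by rewrite block_sandwich rank_sandwich.
have rBT : \rank (Bl *m T) = \rank T.
  by apply/eqP; rewrite eqn_leq mxrankM_maxr -rBTA mxrankM_maxl.
have rTA : \rank (T *m Ah) = \rank T.
  by apply/eqP; rewrite eqn_leq mxrankM_maxl -rBTA -mulmxA mxrankM_maxr.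
have [Q1 TQ1] := rank_mulr_factor rTA; have [Q2 TQ2] := rank_mull_factor rBT.
have TSA : TS *m Ah = T *m Ah.
  rewrite /TS /T -!mulmxA PhE.
  by rewrite (mulmxA Pi Pi) Pi_idem.
have TTS : T = TS *m (Ah *m Q1) by rewrite mulmxA TSA -TQ1.
have rTS : \rank (TS *m (Ah *m Q1)) = \rank TS.
  apply/eqP; rewrite eqn_leq mxrankM_maxl -TTS rT (leq_trans _ rankPi)//.
  exact: leq_trans (mxrankM_maxl _ _) (mxrankM_maxr _ _).
have [Q3 TSQ] := rank_mulr_factor rTS; rewrite -TTS in TSQ.
have BlTE : Bl *m (T - TS) = 0.
  rewrite -TE !mulmxA PlE -(mulmxA Pi N) N_SXY Pi_Sg mulmxBr mulmx1.
  by rewrite -(mulmxA Sg) Pi_idem subrr mul0mx.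
have TTE : T - TS = T *m (1%:M - Q3) by rewrite mulmxBr mulmx1 -TSQ.
by rewrite TE TTE {1}TQ2 -(mulmxA Q2) -(mulmxA Bl) -TTE BlTE mulmx0.
Qed.

End Factorizations.
End CriticalProduct.

Section Network.
Context {R : realType} {d : nat -> nat} {H m : nat}.
Variables (X : 'M[R]_(d 0%N, m)) (Y : 'M[R]_(d H, m)).
Variables (U : 'M[R]_(d H)) (D : 'M[R]_(d H, m)) (V : 'M[R]_m).
Hypothesis hdata : data_assumption X Y.
Hypothesis hsvd : is_svd (SigmaHalf X Y) U D V.
Implicit Types (W : params R d H) (S : {set 'I_(d H)}).

Local Notation N := (regression X Y).
Local Notation Pi := (eigproj U).
Local Notation Sg := (Sigma X Y).
Local Notation SXY := (SigmaXY X Y).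
Local Notation SYX := (SigmaYX X Y).
Local Notation lam := (lam D).

Lemma trmxSXY : SXY^T = SYX.
Proof. by rewrite /SigmaXY /SigmaYX trmx_mul trmxK. Qed.

Lemma eigproj_factor S : Pi S = colset U S *m (colset U S)^T.
Proof. by []. Qed.

Lemma regression_X : N *m X = SigmaHalf X Y.
Proof. by []. Qed.

Lemma SigmaHalf_gram : SigmaHalf X Y *m (SigmaHalf X Y)^T = Sg.
Proof. by []. Qed.

Lemma SXX_gram : X *m X^T = SigmaXX X.
Proof. by []. Qed.

Lemma trmx_eigproj S : (Pi S)^T = Pi S.
Proof. by case: (eigproj_ortho hsvd S). Qed.

Lemma eigproj_idem S : Pi S *m Pi S = Pi S.
Proof. by case: (eigproj_ortho hsvd S). Qed.

Lemma gradmx_eigproj S : gradmx X Y (Pi S *m N) = Pi S *m SYX - SYX.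
Proof.
rewrite /gradmx mulmxBl -(mulmxA _ X) SXX_gram -(mulmxA (Pi S)).
by rewrite (regression_SXX hdata).
Qed.

Lemma rank_eigproj S : (\rank (Pi S) <= #|S|)%N.
Proof. by rewrite eigproj_factor (leq_trans (mxrankM_maxl _ _))// rank_leq_col. Qed.

(** The gradient vanishes only at the regression matrix, which has full rank. *)
Lemma gradmx_eigproj_neq0 S : (\rank (Pi S *m N) < d H)%N ->
  gradmx X Y (Pi S *m N) != 0.
Proof.
move=> rk; rewrite gradmx_eigproj; apply/eqP => /eqP.
rewrite subr_eq0 -{2}(mul1mx SYX) => /eqP /(row_free_inj (SYX_free hdata)) P1.
move: rk; rewrite P1 mul1mx; have /eqP -> := regression_free hdata.
by rewrite ltnn.
Qed.

Lemma Sigma_col i : Sg *m col i U = lam i *: col i U.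
Proof.
rewrite (Sigma_eig hsvd) -!mulmxA.
have -> : U^T *m col i U = delta_mx i 0 by rewrite colE mulmxA (UTU hsvd) mul1mx.
rewrite -colE (_ : col i (diag_mx _) = lam i *: delta_mx i 0).
  by rewrite -scalemxAr -colE.
apply/colP => j; rewrite !mxE andbT eq_sym.
by case: eqVneq => [->|]; rewrite ?mulr1 ?mulr0.
Qed.

Lemma col_UTU i j : (col i U)^T *m col j U = (i == j)%:R%:M.
Proof.
apply/matrixP => a b; have /matrixP/(_ i j) := UTU hsvd.
rewrite !mxE !ord1 eqxx mulr1n => <-.
by apply: eq_bigr => k _; rewrite !mxE.
Qed.

Lemma eigproj_col_in S i : i \in S -> (col i U)^T *m Pi S = (col i U)^T.
Proof.
move=> iS; apply: trmx_inj; rewrite trmx_mul trmxK trmx_eigproj (eigproj_col hsvd).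
by rewrite iS scale1r.
Qed.

Lemma eigproj_col_notin S i : i \notin S -> (col i U)^T *m Pi S = 0.
Proof.
move=> iS; apply: trmx_inj; rewrite trmx_mul trmxK trmx_eigproj (eigproj_col hsvd).
by rewrite (negPf iS) scale0r trmx0.
Qed.

Lemma trmx_Sigma : Sg^T = Sg.
Proof. by rewrite /Sigma trmx_mul trmxK. Qed.

Lemma tr_col_Sigma i : (col i U)^T *m Sg = lam i *: (col i U)^T.
Proof.
apply: trmx_inj; rewrite trmx_mul trmx_Sigma trmxK Sigma_col.
by apply/matrixP => a b; rewrite !mxE.
Qed.

(** The dyads built from the left singular vectors and the corresponding rows
    of the regression matrix are orthogonal for the metric of the fit. *)
Lemma frob_dyads i j k l :
  frob (col i U *m ((col j U)^T *m N) *m X) (col k U *m ((col l U)^T *m N) *m X) =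
  (i == k)%:R * ((j == l)%:R * lam j).
Proof.
have cE a b : col a U *m ((col b U)^T *m N) *m X = col a U *m ((col b U)^T *m SigmaHalf X Y).
  by rewrite -(mulmxA (col a U)) -(mulmxA (col b U)^T) regression_X.
rewrite !cE frob_mull mulmxA col_UTU mul_scalar_mx frobZr; congr (_ * _).
rewrite frob_mulr -mulmxA SigmaHalf_gram.
rewrite tr_col_Sigma frobZr mulrC; have [<-|jl] := eqVneq j l.
  by rewrite /frob trmxK col_UTU eqxx mxtrace1.
by rewrite /frob trmxK col_UTU (negPf jl) mul0r raddf0 mxtrace0 mul0r.
Qed.

End Network.

(** * Descent by exchanging eigenvectors *)

Section DescentDirections.
Context {R : realType} {d : nat -> nat} {K m : nat}.
Variables (X : 'M[R]_(d 0%N, m)) (Y : 'M[R]_(d K.+1, m)).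
Variables (U : 'M[R]_(d K.+1)) (D : 'M[R]_(d K.+1, m)) (V : 'M[R]_m).
Hypothesis hdata : data_assumption X Y.
Hypothesis hsvd : is_svd (SigmaHalf X Y) U D V.
Hypothesis K_gt0 : (0 < K)%N.
Variables (W : params R d K.+1) (S : {set 'I_(d K.+1)}).
Hypothesis WE : endtoend W = eigproj U S *m regression X Y.

Local Notation N := (regression X Y).
Local Notation u i := (col i U).
Local Notation n i := ((col i U)^T *m N).

(** Rotating the eigenvector i in S towards an eigenvector j outside S with a
    larger eigenvalue decreases the loss to second order. The last layer turns
    the output direction and the first layer turns the input direction. *)
Lemma neg_curvature_swap i j : i \in S -> j \notin S -> (j < i)%N ->
  exists V', curvature X Y W V' < 0.
Proof.
move=> iS jS ji.
have lam_gap := lam_lt hdata hsvd ji.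
have ij : (i == j) = false by apply/negbTE; rewrite neq_ltn ji orbT.
(* A preimage of the eigenvector i under the product of the weights. *)
pose c := (lam D i)^-1 *: (SigmaXY X Y *m u i).
have cE : endtoend W *m c = u i.
  rewrite WE -scalemxAr -(mulmxA (eigproj U S)) (mulmxA N) (regression_SXY hdata).
  rewrite (Sigma_col hsvd) -scalemxAr scalerA mulVf ?gt_eqF ?(lam_gt0 hdata hsvd)//.
  by rewrite scale1r (eigproj_col hsvd) iS scale1r.
pose b := weight W 0%N *m c.
have bE : wprod W K.+1 1 *m b = u i.
  by rewrite /b mulmxA -[weight W 0%N]wprod1 -wprod_split.
pose M := u j *m ((u i)^T *m weight W K).
pose M' : 'M[R]_(d 1%N, d 0%N) := b *m n j.
exists (two_layers M M').
have dE : dwprod W (two_layers M M') K.+1 0 = u j *m n i + u i *m n j.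
  rewrite dwprod_two_layers// !wprodnn mul1mx mulmx1 /M' (mulmxA _ b) bE.
  congr (_ + _).
  rewrite /M -(mulmxA (u j)) -(mulmxA (u i)^T) -wprodS// -/(endtoend W) WE.
  by rewrite (mulmxA (u i)^T) (eigproj_col_in hsvd iS).
have d2E : d2wprod W (two_layers M M') (two_layers M M') K.+1 0 = u j *m n j.
  rewrite d2wprod_two_layers ?K_gt0 ?ltnSn//.
  rewrite !wprodnn mul1mx mulmx1 /M /M'.
  rewrite -(mulmxA (u j)) -(mulmxA (u i)^T) -wprodS//.
  rewrite (mulmxA _ b (n j)) -(mulmxA (u j)) -(mulmxA (u i)^T) bE.
  by rewrite (col_UTU hsvd) eqxx mulmx1.
have gE : frob (eigproj U S *m SigmaYX X Y - SigmaYX X Y) (u j *m n j) = - lam D j.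
  rewrite frobC frob_mull mulmxBr (mulmxA _ (eigproj U S)) (eigproj_col_notin hsvd jS) mul0mx sub0r.
  rewrite frobC frobNl frobC -trmxSXY -frob_mulr -(mulmxA (u j)^T).
  rewrite (regression_SXY hdata) (tr_col_Sigma hsvd) frobZl.
  by rewrite /frob trmxK (col_UTU hsvd) eqxx mxtrace1 mulr1.
rewrite /curvature dE d2E frob_residual WE (gradmx_eigproj U hdata).
rewrite gE mulmxDl frobsqD !frobsqE !(frob_dyads hsvd) !eqxx (eq_sym j) ij.
by move: lam_gap; rewrite !mul1r !mul0r mulr0; lra.
Qed.

End DescentDirections.

(** * Pivots *)

Section Pivots.
Context {R : realType} {d : nat -> nat} {H m : nat}.
Variables (X : 'M[R]_(d 0%N, m)) (Y : 'M[R]_(d H, m)).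
Variables (U : 'M[R]_(d H)) (D : 'M[R]_(d H, m)) (V : 'M[R]_m).
Hypothesis hdata : data_assumption X Y.
Hypothesis hsvd : is_svd (SigmaHalf X Y) U D V.
Variables (W : params R d H) (S : {set 'I_(d H)}).
Hypothesis WE : endtoend W = eigproj U S *m regression X Y.
Hypothesis cardS : #|S| = \rank (endtoend W).

Local Notation N := (regression X Y).
Local Notation Pi := (eigproj U S).
Local Notation SXY := (SigmaXY X Y).
Local Notation G := (gradmx X Y (endtoend W)).
Local Notation B h := (wprod W H h.+1).
Local Notation A l := (wprod W l 0).

Lemma rank_Pi : (\rank Pi <= \rank (Pi *m N))%N.
Proof. by rewrite -WE -cardS rank_eigproj. Qed.

Lemma split_at h : (h <= H)%N -> wprod W H h *m A h = Pi *m N.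
Proof. by move=> hH; rewrite -WE /endtoend -wprod_split. Qed.

(** The gradient seen by two layers is the part of the first complementary block
    of their pivot outside the range of Pi. *)
Lemma gradmx_block h l :
  (B h)^T *m G *m (A l)^T = - (A l *m SXY *m (1%:M - Pi) *m B h)^T.
Proof.
have -> : G = - ((1%:M - Pi) *m SXY^T).
  by rewrite WE (gradmx_eigproj U hdata) trmxSXY mulmxBl mul1mx opprB.
rewrite !trmx_mul [in RHS]linearB /= trmx1 (trmx_eigproj hsvd).
by rewrite mulmxN mulNmx !mulmxA.
Qed.

(** The second block has larger rank than P, so some combination of its rows,
    given by b, or of its columns, given by c, is lost below or above it: moving one layer through b or c leaves the product
    unchanged to first order. Since the first block also has larger rank than P,
    it does not factor through Pi, so the entries left free in the two layers
    can be chosen to make the pairing of G with the cross term nonzero. *)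
Lemma not_tightened_neg_curvature h l : (l < h < H)%N ->
  ~ tightened_pivot X Y W h.+1 l.+1 -> exists V', curvature X Y W V' < 0.
Proof.
move=> lhH; have /andP[lh hH] := lhH; have lH := ltn_trans lh hH.
rewrite /tightened_pivot /= WE => /not_orP[/eqP rT /eqP rC].
have PE : wprod W H h *m wprod W h l.+1 *m wprod W l.+1 0 = Pi *m N.
  by rewrite -wprod_split ?split_at// ltnW.
have {}rC : (\rank (Pi *m N) < \rank (wprod W h l.+1))%N.
  rewrite ltn_neqAle eq_sym rC -PE.
  exact: leq_trans (mxrankM_maxl _ _) (mxrankM_maxr _ _).
have {}rT : (\rank (Pi *m N) < \rank (A l *m SXY *m B h))%N.
  rewrite ltn_neqAle eq_sym rT /=.
  exact: (rank_block (eigproj_idem hsvd S) (eigproj_Sigma hsvd S) (regression_SXY hdata)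
           (Sigma_unit hdata) (split_at (ltnW lH)) (split_at hH)).
have K0 : (B h)^T *m G *m (A l)^T != 0.
  rewrite gradmx_block oppr_eq0 trmx_eq0.
  exact: block_neq0 rank_Pi rT.
have [al [be Kab]] := matrix0Pn _ K0.
pose a : 'cV[R]_(d h.+1) := delta_mx al 0; pose e : 'rV[R]_(d l) := delta_mx 0 be.
have Kae : frob ((B h)^T *m G *m (A l)^T) (a *m e) != 0.
  by rewrite (_ : a *m e = delta_mx al be) ?frob_delta//; exact: mul_delta_mx.
have fin (b : 'rV[R]_(d h)) (c : 'cV[R]_(d l.+1)) :
    b *m wprod W h l.+1 *m c != 0 ->
    wprod W H l.+1 *m c = 0 \/ b *m wprod W h 0 = 0 ->
    exists V', curvature X Y W V' < 0.
  move=> bCc cb; apply: (@neg_curvature_two_layers _ _ _ _ _ _ _ h (a *m b) l (c *m e)) => //.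
    case: cb => [c0|b0]; [right|left].
      by rewrite (mulmxA _ c) c0 !mul0mx.
    by rewrite -!mulmxA b0 !mulmx0.
  have scE : b *m wprod W h l.+1 *m c = ((b *m wprod W h l.+1 *m c) 0 0)%:M.
    exact: mx11_scalar.
  have -> : wprod W H h.+1 *m (a *m b) *m wprod W h l.+1 *m (c *m e) *m wprod W l 0 =
      (b *m wprod W h l.+1 *m c) 0 0 *: (B h *m (a *m e) *m A l).
    transitivity (B h *m a *m (b *m wprod W h l.+1 *m c) *m e *m A l).
      by rewrite !mulmxA.
    by rewrite {1}scE mul_mx_scalar -!scalemxAl -(mulmxA _ a).
  rewrite frobZr mulf_eq0 negb_or; apply/andP; split.
    apply: contra bCc => /eqP s0; rewrite scE s0.
    by apply/eqP/matrixP => i j; rewrite !mxE mul0rn.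
  by rewrite frobC frob_mulr frob_mull frobC mulmxA.
have rPC : (\rank (wprod W H h *m wprod W h l.+1 *m wprod W l.+1 0) <
    \rank (wprod W h l.+1))%N by rewrite PE.
have [[c c0 Cc]|[b b0 bC]] := middle_rank_drop rPC.
  have [b bCc] := ex_mulmxl_neq0 (k := 1) isT Cc.
  apply: (fin b c); first by rewrite -mulmxA.
  by left; rewrite (@wprod_split _ _ _ _ H h)// ltnW.
have [c bCc] := ex_mulmxr_neq0 (k := 1) isT bC.
by apply: (fin b c) => //; right; rewrite (@wprod_split _ _ _ _ h l.+1)// mulmxA.
Qed.

(** If the first block has the rank of P, then G is orthogonal to both sides; if
    the second block has it, that block is recovered by [middle_factor] from the
    products above and below. *)
Lemma tightened_pivot_factor h l (M : 'M[R]_(d h.+1, d h)) (M' : 'M[R]_(d l.+1, d l)) :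
  (l < h < H)%N -> tightened_pivot X Y W h.+1 l.+1 ->
  frob G (B h *m M *m wprod W h l.+1 *m M' *m A l) =
  frob G (B h *m M *m A h *m (SXY *m invmx (Sigma X Y) *m Pi) *m
          (B l *m M' *m A l)).
Proof.
move=> lhH; have /andP[lh hH] := lhH; have lH := ltn_trans lh hH.
rewrite /tightened_pivot /= WE => -[rT|rC].
  have K0 : (B h)^T *m gradmx X Y (Pi *m N) *m (A l)^T = 0.
    rewrite -WE gradmx_block.
    rewrite (block_eq0 (eigproj_idem hsvd S) (eigproj_Sigma hsvd S) (regression_SXY hdata)
           (Sigma_unit hdata) (split_at (ltnW lH)) (split_at hH) rank_Pi rT).
    by rewrite trmx0 oppr0.
  have frob0 (C : 'M[R]_(d h.+1, d l)) : frob (gradmx X Y (Pi *m N)) (B h *m C *m A l) = 0.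
    by rewrite frobC frob_mulr frob_mull frobC mulmxA K0 frob0l.
  set J := SXY *m invmx (Sigma X Y) *m Pi.
  rewrite (_ : B h *m M *m wprod W h l.+1 *m M' *m A l =
    B h *m (M *m wprod W h l.+1 *m M') *m A l); last by rewrite !mulmxA.
  rewrite (_ : B h *m M *m A h *m J *m (B l *m M' *m A l) =
    B h *m (M *m A h *m J *m B l *m M') *m A l); last by rewrite !mulmxA.
  by rewrite !frob0.
have PE : wprod W H h *m wprod W h l.+1 *m wprod W l.+1 0 = Pi *m N.
  by rewrite -wprod_split ?split_at// ltnW.
have CE := @middle_factor _ _ _ _ _ (wprod W H h) (wprod W h l.+1) (wprod W l.+1 0)
  (SXY *m invmx (Sigma X Y) *m Pi).
rewrite PE in CE; have {}CE := CE (esym rC)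
  (ginvP (eigproj_idem hsvd S) (regression_SXY hdata) (Sigma_unit hdata)).
rewrite -!wprod_split// ?(ltnW hH)// in CE.
by rewrite {1}CE !mulmxA.
Qed.

End Pivots.

(** * Nonnegative curvature at tightened points *)

Lemma svd_coords_sandwich (F : comPzRingType) p q m (U : 'M[F]_p) (V : 'M[F]_m)
    (M : 'M[F]_(p, q)) (X : 'M[F]_(q, m)) (al D : 'M[F]_(p, m)) (L : 'M[F]_p) :
  U^T *m U = 1%:M -> V^T *m V = 1%:M -> M *m X = U *m al *m V^T ->
  M *m (X *m (U *m D *m V^T)^T *m (U *m L *m U^T)) *m M *m X =
  U *m (al *m D^T *m L *m al) *m V^T.
Proof.
move=> UTU VTV MX; rewrite !trmx_mul trmxK !mulmxA MX -(mulmxA _ M X) MX !mulmxA.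
rewrite -(mulmxA _ V^T V) VTV mulmx1.
by rewrite -!(mulmxA _ U^T U) UTU !mulmx1.
Qed.

Section Tightened.
Context {R : realType} {d : nat -> nat} {H m : nat}.
Variables (X : 'M[R]_(d 0%N, m)) (Y : 'M[R]_(d H, m)).
Variables (U : 'M[R]_(d H)) (D : 'M[R]_(d H, m)) (V : 'M[R]_m).
Hypothesis hdata : data_assumption X Y.
Hypothesis hsvd : is_svd (SigmaHalf X Y) U D V.

Local Notation N := (regression X Y).
Local Notation SXY := (SigmaXY X Y).
Local Notation Sg := (Sigma X Y).
Local Notation lam := (lam D).

Lemma weighted_pair_le (a b s t : R) : 0 < s -> 0 <= t <= s ->
  2 * ((a * s) * ((s ^+ 2)^-1 * (b * t))) <= a ^+ 2 + b ^+ 2.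
Proof.
move=> s0 /andP[t0 ts].
have -> : 2 * ((a * s) * ((s ^+ 2)^-1 * (b * t))) = 2 * (a * b) * (t / s).
  by field; rewrite gt_eqF.
have q0 : 0 <= t / s by rewrite divr_ge0// ltW.
have q1 : t / s <= 1 by rewrite ler_pdivrMr// mul1r.
move: (t / s) q0 q1 => q q0 q1.
have h1 : 0 <= (a - b) ^+ 2 by exact: sqr_ge0.
have h2 : 0 <= (a + b) ^+ 2 by exact: sqr_ge0.
nra.
Qed.

(** In singular coordinates the cross terms pair a coefficient in a leading row
    with one in a later row, with a weight below 1 since the singular values
    decrease; each square is used at most once. *)
Lemma spectral_pairing_ge0 (al : 'M[R]_(d H, m)) k :
  2 * frob (al *m D^T *m diag_mx (\row_i ((i < k)%N%:R * (lam i)^-1)) *m (al *m D^T))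
           (diag_mx (\row_(i < d H) (k <= i)%N%:R)) <= frobsq al.
Proof.
pose be i j := al i (diag_idx hdata j).
pose sg i := D i (diag_idx hdata i).
have sg0 i : 0 < sg i.
  by rewrite lt_neqAle (singular_ge0 hdata hsvd) andbT eq_sym -sqrf_eq0 -(lamE hdata hsvd)
     gt_eqF// (lam_gt0 hdata hsvd).
have aD i j : (al *m D^T) i j = be i j * sg j.
  rewrite mxE (bigD1 (diag_idx hdata j))//= big1 ?addr0 ?mxE// => l lj.
  rewrite mxE (D_diag hsvd) ?mulr0//.
  by apply: contra lj => /eqP jl; apply/eqP/val_inj.
have frobE2 : frob (al *m D^T *m diag_mx (\row_i ((i < k)%N%:R * (lam i)^-1)) *m (al *m D^T))
           (diag_mx (\row_(i < d H) (k <= i)%N%:R)) =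
   \sum_(i < d H) \sum_(j < d H) (k <= i)%N%:R * ((j < k)%N%:R *
      ((be i j * sg j) * ((sg j ^+ 2)^-1 * (be j i * sg i)))).
  rewrite frobE; apply: eq_bigr => i _; rewrite (bigD1 i)//= big1 ?addr0 => [|l li].
    rewrite [in X in _ * X]mxE [in X in _ * X]mxE eqxx mulr1n mxE mulr_suml.
    apply: eq_bigr => j _; rewrite mul_mx_diag [in X in X * _ * _]mxE !aD.
    by rewrite mxE (lamE hdata hsvd); ring.
  by rewrite [X in _ * X]mxE eq_sym (negPf li) mulr0.
have low : \sum_(i < d H) \sum_(j < d H) be i j ^+ 2 <= frobsq al.
  apply: ler_sum => i _.
  have -> : \sum_(j < d H) be i j ^+ 2 = \sum_(c < m | (c < d H)%N) al i c ^+ 2.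
    by rewrite (big_ord_narrow (dy_le_m hdata)).
  rewrite [leRHS](bigID (fun c : 'I_m => (c < d H)%N))/= lerDl.
  by apply: sumr_ge0 => c _; rewrite sqr_ge0.
apply: le_trans low; rewrite frobE2 mulr_sumr.
have pairs : \sum_(i < d H) \sum_(j < d H) (k <= i)%N%:R * ((j < k)%N%:R * (be i j ^+ 2 + be j i ^+ 2)) <=
    \sum_(i < d H) \sum_(j < d H) be i j ^+ 2.
  have -> : \sum_(i < d H) \sum_(j < d H) (k <= i)%N%:R * ((j < k)%N%:R * (be i j ^+ 2 + be j i ^+ 2)) =
      \sum_(i < d H) \sum_(j < d H) ((k <= i)%N%:R * (j < k)%N%:R + (k <= j)%N%:R * (i < k)%N%:R) * be i j ^+ 2.
    under eq_bigr => i _ do under eq_bigr => j _ do rewrite mulrA mulrDr.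
    under [RHS]eq_bigr => i _ do under eq_bigr => j _ do rewrite mulrDl.
    under eq_bigr => i _ do rewrite big_split /=.
    under [RHS]eq_bigr => i _ do rewrite big_split /=.
    rewrite !big_split /=; congr (_ + _).
    by rewrite exchange_big.
  apply: ler_sum => i _; apply: ler_sum => j _; rewrite -[leRHS]mul1r.
  rewrite ler_wpM2r ?sqr_ge0//.
  by case: (leqP k i); case: (leqP k j); rewrite /= ?mulr0 ?mulr1 ?addr0 ?add0r ?lexx ?ler01.
apply: le_trans pairs; apply: ler_sum => i _; rewrite mulr_sumr; apply: ler_sum => j _.
case: (leqP k i) => ki; last by rewrite !mul0r mulr0.
case: (ltnP j k) => jk; last by rewrite !mul0r !mulr0.
rewrite !mul1r; apply: weighted_pair_le; first exact: sg0.
rewrite ltW//=.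
by case: hsvd => _ _ _ _ [_ h]; apply: h => //; exact: ltnW (leq_trans jk ki).
Qed.

Lemma svd_coords (A : 'M[R]_(d H, m)) : exists al, A = U *m al *m V^T.
Proof.
exists (U^T *m A *m V).
by rewrite !mulmxA (UUT hsvd) mul1mx -mulmxA (VVT hsvd) mulmx1.
Qed.

Lemma frob_svd_coords (A B : 'M[R]_(d H, m)) :
  frob (U *m A *m V^T) (U *m B *m V^T) = frob A B.
Proof.
rewrite frob_mulr trmxK -mulmxA (VTV hsvd) mulmx1 frob_mull mulmxA (UTU hsvd).
by rewrite mul1mx.
Qed.

Lemma inv_Sigma_eigproj k : invmx Sg *m eigproj U (first_indices (d H) k) =
  U *m diag_mx (\row_i ((i < k)%N%:R * (lam i)^-1)) *m U^T.
Proof.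
rewrite -[RHS](mulKmx (Sigma_unit hdata)); congr (_ *m _).
rewrite (Sigma_eig hsvd) (eigprojE U) !mulmxA -(mulmxA _ U^T U) (UTU hsvd) mulmx1.
rewrite -(mulmxA U (diag_mx _) (diag_mx _)) mulmx_diag; congr (_ *m diag_mx _ *m _).
apply/rowP => i; rewrite !mxE inE mulrCA divff ?mulr1//.
by rewrite gt_eqF// (lam_gt0 hdata hsvd).
Qed.

Lemma coeigproj_eig k : 1%:M - eigproj U (first_indices (d H) k) =
  U *m diag_mx (\row_(i < d H) (k <= i)%N%:R) *m U^T.
Proof.
rewrite (eigprojE U) -{1}(UUT hsvd) -{1}(mulmx1 U) -mulmxBl -mulmxBr.
congr (_ *m _ *m _); apply/matrixP => i j; rewrite !mxE inE.
by case: eqVneq => _; rewrite ?mulr0n ?subrr// !mulr1n; case: ltnP; rewrite ?subrr ?subr0.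
Qed.

Local Notation Pi k := (eigproj U (first_indices (d H) k)).

(** For M tangent to the matrices of rank at most k, this is, up to a factor
    2, the second variation of the fit on that variety at its minimizer; J = SXY Sg^-1 Pi is a
    generalized inverse of Pi N. *)
Lemma truncation_second_variation_ge0 k (M : 'M[R]_(d H, d 0%N)) :
  0 <= frobsq (M *m X) +
       2 * frob (gradmx X Y (Pi k *m N)) (M *m (SXY *m invmx Sg *m Pi k) *m M).
Proof.
have [al alE] := svd_coords (M *m X).
have MXE : M *m (SXY *m invmx Sg *m Pi k) *m M *m X =
    U *m (al *m D^T *m diag_mx (\row_i ((i < k)%N%:R * (lam i)^-1)) *m al) *m V^T.
  rewrite -(mulmxA SXY) inv_Sigma_eigproj -(X_SigmaHalfT hdata) (SigmaHalf_svd hsvd).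
  exact: svd_coords_sandwich (UTU hsvd) (VTV hsvd) alE.
have GE : frob (gradmx X Y (Pi k *m N)) (M *m (SXY *m invmx Sg *m Pi k) *m M) =
    - frob (al *m D^T *m diag_mx (\row_i ((i < k)%N%:R * (lam i)^-1)) *m (al *m D^T))
           (diag_mx (\row_(i < d H) (k <= i)%N%:R)).
  rewrite (gradmx_eigproj U hdata).
  have -> : Pi k *m SigmaYX X Y - SigmaYX X Y = - ((1%:M - Pi k) *m SigmaHalf X Y *m X^T).
    rewrite -(mulmxA _ _ X^T) -trmxSXY -(X_SigmaHalfT hdata) trmx_mul trmxK.
    by rewrite mulmxBl mul1mx opprB.
  rewrite frobNl; congr (- _).
  rewrite frob_mulr trmxK MXE coeigproj_eig (SigmaHalf_svd hsvd).
  move: (diag_mx _) (diag_mx _) => L' L.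
  rewrite (_ : U *m L *m U^T *m (U *m D *m V^T) = U *m (L *m D) *m V^T); last first.
    by rewrite !mulmxA -(mulmxA _ U^T U) (UTU hsvd) mulmx1.
  by rewrite frob_svd_coords frobC mulmxA [RHS]frob_mulr trmxK.
rewrite GE alE (frobsq_mul_unitaryr _ (VTV hsvd)) (frobsq_mul_unitaryl _ (UTU hsvd)).
by rewrite mulrN subr_ge0 spectral_pairing_ge0.
Qed.

Section TightenedPoint.
Variables (W : params R d H) (S : {set 'I_(d H)}).
Hypothesis WE : endtoend W = eigproj U S *m N.
Hypothesis cardS : #|S| = \rank (endtoend W).
Hypothesis Wcrit : layer_critical X Y W.
Hypothesis Wtight : tightened X Y W.

Local Notation G := (gradmx X Y (endtoend W)).
Local Notation J := (SXY *m invmx Sg *m eigproj U S).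

(** The pairs of layers in the wrong order contribute nothing, by first-order
    criticality, so the sum over the pivots completes to a full double sum. *)
Lemma tightened_second_variation V' :
  frob G (d2wprod W V' V' H 0) =
  frob G (dwprod W V' H 0 *m J *m dwprod W V' H 0).
Proof.
pose F h := wprod W H h.+1 *m weight V' h *m wprod W h 0.
have low h l : (h <= l < H)%N -> frob G (F h *m J *m F l) = 0.
  move=> /andP[hl lH]; rewrite /F (@wprod_split _ _ _ _ H l.+1 h.+1)//.
  set T := weight V' h *m wprod W h 0 *m J *m wprod W H l.+1 *m weight V' l.
  rewrite (_ : _ *m _ = wprod W H l.+1 *m (wprod W l.+1 h.+1 *m T) *m wprod W l 0).
    by rewrite frobC frob_mulr frob_mull frobC mulmxA Wcrit// frob0l.
  by rewrite /T !mulmxA.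
rewrite /d2wprod /dwprod mulmx_suml mulmx_suml !frob_sumr.
apply: eq_big_nat => h /andP[_ hH]; rewrite mulmx_sumr !frob_sumr.
rewrite [RHS](@big_cat_nat _ _ _ h)//= ?(ltnW hH)//.
rewrite [X in _ + X]big_nat [X in _ + X]big1 ?addr0 => [|l hl]; last exact: low.
apply: eq_big_nat => l /andP[_ lh].
apply: (tightened_pivot_factor hdata hsvd WE cardS) => //; first by rewrite lh.
by apply: Wtight; rewrite ?ltnS.
Qed.

Lemma tightened_curvature_ge0 V' :
  S = first_indices (d H) #|S| -> 0 <= curvature X Y W V'.
Proof.
move=> S1; rewrite /curvature frob_residual tightened_second_variation WE S1.
exact: truncation_second_variation_ge0.
Qed.

End TightenedPoint.
End Tightened.

(** * Classification of the critical points *)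

Theorem theorem7 (R : realType) (H : nat) (d : nat -> nat) (m : nat)
    (hH : (2 <= H)%N) (hd : forall h, (h <= H)%N -> (0 < d h)%N) (hm : (0 < m)%N)
    (X : 'M[R]_(d 0%N, m)) (Y : 'M[R]_(d H, m)) (hdata : data_assumption X Y)
    (U : 'M[R]_(d H)) (D : 'M[R]_(d H, m)) (V : 'M[R]_m)
    (hsvd : is_svd (SigmaHalf X Y) U D V)
    (W : params R d H)
    (hcrit : first_order_critical (vloss X Y) (vectorize W))
    (r : nat) (hr : r = \rank (endtoend W))
    (S : {set 'I_(d H)}) (hS : associated X Y U W S) :
  (r <= rmax d H)%N /\
  (r = rmax d H ->
     (S = first_indices (d H) (rmax d H) ->
        global_minimizer (vloss X Y) (vectorize W)) /\
     (S <> first_indices (d H) (rmax d H) ->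
        ~ second_order_critical (vloss X Y) (vectorize W) /\
        strict_saddle_point (vloss X Y) (vectorize W))) /\
  ((r < rmax d H)%N ->
     saddle_point (vloss X Y) (vectorize W) /\
     (S <> first_indices (d H) r ->
        ~ second_order_critical (vloss X Y) (vectorize W) /\
        strict_saddle_point (vloss X Y) (vectorize W)) /\
     (S = first_indices (d H) r ->
        (endtoend W
           = colset U S *m (colset U S)^T *m SigmaYX X Y *m invmx (SigmaXX X) /\
         (\rank (endtoend W) <= r)%N /\
         (forall M : 'M[R]_(d H, d 0%N), (\rank M <= r)%N ->
            frobsq (endtoend W *m X - Y) <= frobsq (M *m X - Y))) /\
        (~ tightened X Y W ->
           ~ second_order_critical (vloss X Y) (vectorize W) /\
           strict_saddle_point (vloss X Y) (vectorize W)) /\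
        (tightened X Y W ->
           second_order_critical (vloss X Y) (vectorize W) /\
           nonstrict_saddle_point (vloss X Y) (vectorize W)))).
Proof.
case: H hH d hd X Y hdata U D hsvd W hcrit r hr S hS => [//|K] hK {}d {}hd {}X {}Y {}hdata
  {}U {}D {}hsvd {}W {}hcrit {}r {}hr {}S [cardS WS].
have WE : endtoend W = eigproj U S *m regression X Y by rewrite mulmxA.
have Wcrit := critical_layer_critical hcrit.
have nomax := no_local_maximizer hd (X_free hdata) (ltn0Sn K) (x := vectorize W) (Y := Y).
have strict V' := neg_curvature_strict hcrit nomax (V := V').
have rS : #|S| = r by rewrite hr.
have r_le : (r <= rmax d K.+1)%N.
  by apply/rmax_geP => h hh; rewrite hr rank_endtoend.
have swap : S <> first_indices (d K.+1) r ->
    ~ second_order_critical (vloss X Y) (vectorize W) /\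
    strict_saddle_point (vloss X Y) (vectorize W).
  rewrite -rS => /not_first_indices[i [j [iS jS ji]]].
  have [V' V'neg] := neg_curvature_swap hdata hsvd hK WE iS jS ji.
  exact: strict V'neg.
have best k : S = first_indices (d K.+1) k -> forall M : 'M[R]_(d K.+1, d 0%N),
    (\rank M <= k)%N -> frobsq (endtoend W *m X - Y) <= frobsq (M *m X - Y).
  by move=> S1 M rM; rewrite WE S1 (eckart_young hdata hsvd).
split=> //; split=> [rmaxE|r_lt].
  split=> [S1 y|]; last by rewrite -rmaxE.
  rewrite /vloss /loss vectorizeK; apply: (best (rmax d K.+1)) => //.
  by apply/rmax_geP => h hh; rewrite rank_endtoend.
have saddle : saddle_point (vloss X Y) (vectorize W).
  split=> // Wmin.
  have rkP : (\rank (endtoend W) < rmax d K.+1)%N by rewrite -hr.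
  have flat : flat_minimizer X Y (endtoend W) (vectorize W).
    by split=> //; rewrite vectorizeK.
  have := low_rank_minimizer_gradmx rkP (ltn0Sn K) flat.
  apply/eqP; rewrite WE; apply: (gradmx_eigproj_neq0 hdata); rewrite -WE.
  have /rmax_geP d_ge := leqnn (rmax d K.+1).
  by rewrite (leq_trans rkP)// d_ge.
split=> //; split=> // S1.
split; first by split; [exact: WS | split; [rewrite hr | exact: best S1]].
split=> [Wnot|Wtight].
  have [V' V'neg] : exists V', curvature X Y W V' < 0.
    apply: contrapT => noneg; apply: Wnot => -[//|i] [//|j] _ ji iH.
    apply: contrapT => npiv; apply: noneg.
    by apply: (not_tightened_neg_curvature hdata hsvd WE cardS _ npiv); rewrite -ltnS ji.
  exact: strict V'neg.
have so : second_order_critical (vloss X Y) (vectorize W).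
  apply/vloss_second_orderP; split=> // v.
  rewrite d2loss_curvature vectorizeK mulr_ge0//.
  by apply: (tightened_curvature_ge0 hdata hsvd WE cardS Wcrit Wtight); rewrite rS.
by split.
Qed.
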